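(* Let $n\geq 2$, let $\alpha=(\alpha_1,\dots,\alpha_n)\in\mathbb{R}^n\setminus\{0\}$, and let $\mathbb{D}_\alpha$ be the elementary Reinhardt domain defined below. Let $a=(a_1,\dots,a_n)\in\mathbb{D}_\alpha$ satisfy $\sigma(a)\geq 2$, where $\sigma(a):=\#\{j\in\{1,\dots,n\}:\alpha_j>0,\ a_j=0\}$. Let $\mu(a):=\min\{\alpha_j:\alpha_j>0,\ a_j=0\}$. Then $$\boldsymbol{s}_{\mathbb{D}_\alpha}(a,z)=|z^\alpha|^{1/\mu(a)}\quad\text{for all } z\in\mathbb{D}_\alpha,$$ where $|z^\alpha|:=|z_1|^{\alpha_1}\cdots|z_n|^{\alpha_n}$.
   Context: Let $\mathbb{C}^n(\alpha):=\{(z_1,\dots,z_n)\in\mathbb{C}^n:\ z_j\neq 0 \text{ for every } j \text{ with } \alpha_j<0\}$, and $\mathbb{D}_\alpha:=\{z\in\mathbb{C}^n(\alpha): |z_1|^{\alpha_1}\cdots|z_n|^{\alpha_n}<1\}$ (here $|z_j|^0:=1$). For a domain $G\subset\mathbb{C}^n$ and $a\in G$, let $\mathcal{S}_G(a)$ be the set of functions $u:G\to[0,1)$ such that $\log u$ is plurisubharmonic on $G$, $u(a)=0$, and $u$ is of class $\mathcal{C}^2$ in some neighborhood of $a$. The Sibony function of $G$ is $\boldsymbol{s}_G(a,z):=\sup\{\sqrt{u(z)}: u\in\mathcal{S}_G(a)\}$ for $a,z\in G$. *)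

(* Defs.v *)
From HB Require Import structures.
From mathcomp Require Import all_boot all_order all_algebra.
From mathcomp Require Import all_classical all_reals all_analysis.
Set Implicit Arguments. Unset Strict Implicit. Unset Printing Implicit Defensive.
Import Order.TTheory GRing.Theory Num.Theory.
Import numFieldNormedType.Exports.
Local Open Scope classical_set_scope.
Local Open Scope ring_scope.

(* C^n is modelled as R^n x R^n : a point z is (Re z, Im z). *)
Definition Cn (R : realType) (n : nat) := ('rV[R]_n * 'rV[R]_n)%type.

Section Defs.
Variable R : realType.
Variable n : nat.

Definition re (z : Cn R n) (j : 'I_n) : R := z.1 ord0 j.
Definition im (z : Cn R n) (j : 'I_n) : R := z.2 ord0 j.
Definition cabs (z : Cn R n) (j : 'I_n) : R := Num.sqrt (re z j ^+ 2 + im z j ^+ 2).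

(* the point z + (s + i t) w of the complex line through z in direction w *)
Definition cline (z w : Cn R n) (s t : R) : Cn R n :=
  (z.1 + s *: w.1 - t *: w.2, z.2 + s *: w.2 + t *: w.1).

Definition usc_at (v : Cn R n -> \bar R) (z : Cn R n) : Prop :=
  forall c : R, (v z < c%:E)%E -> \forall y \near z, (v y < c%:E)%E.

Definition psh (G : set (Cn R n)) (v : Cn R n -> \bar R) : Prop :=
  (forall z, G z -> v z != +oo%E) /\
  (forall z, G z -> usc_at v z) /\
  (forall z w (r : R), G z -> 0 < r ->
     (forall s t : R, s ^+ 2 + t ^+ 2 <= r ^+ 2 -> G (cline z w s t)) ->
     (v z <= ((2 * pi)^-1)%:E *
        \int[lebesgue_measure]_(th in `[0%R, (2 * pi)%R])
           v (cline z w (r * cos th) (r * sin th)))%E).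

Definition C2_near (G : set (Cn R n)) (u : Cn R n -> R) (a : Cn R n) : Prop :=
  exists U : set (Cn R n), [/\ open U, U a, U `<=` G &
    forall v w : Cn R n,
      (forall x, U x -> derivable u x v /\ derivable ('D_v u) x w) /\
      (forall x, U x -> {for x, continuous ('D_w ('D_v u))})].

Definition S_class (G : set (Cn R n)) (a : Cn R n) (u : Cn R n -> R) : Prop :=
  [/\ forall z, G z -> 0 <= u z < 1,
      psh G (fun z => lne (u z)%:E),
      u a = 0 &
      C2_near G u a].

Definition sibony (G : set (Cn R n)) (a z : Cn R n) : R :=
  sup [set x : R | exists2 u, S_class G a u & x = Num.sqrt (u z)].

(* |z^alpha| = prod_j |z_j|^alpha_j, with |z_j|^0 := 1 (powR 0 0 = 1) *)
Definition zpow (alpha : 'I_n -> R) (z : Cn R n) : R :=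
  \prod_(j < n) (cabs z j `^ alpha j).

Definition Dalpha (alpha : 'I_n -> R) : set (Cn R n) :=
  [set z | (forall j, alpha j < 0 -> cabs z j != 0) /\ zpow alpha z < 1].

Definition Jset (alpha : 'I_n -> R) (a : Cn R n) : {set 'I_n} :=
  [set j | (0 < alpha j) && (cabs a j == 0)].
Definition sigma (alpha : 'I_n -> R) (a : Cn R n) : nat := #|Jset alpha a|.
(* minimum of the finite set {alpha_j : j in Jset}, written as its infimum *)
Definition mu (alpha : 'I_n -> R) (a : Cn R n) : R :=
  inf [set alpha j | j in [set j | j \in Jset alpha a]].

End Defs.

(* Main.v *)
Require Import Defs.
From HB Require Import structures.
From mathcomp Require Import all_boot all_order all_algebra.
From mathcomp Require Import all_classical all_reals all_analysis.
From mathcomp Require Import measurable_realfun.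
From mathcomp Require Import ring lra.
Import Order.TTheory GRing.Theory Num.Theory.
Import numFieldNormedType.Exports.
Local Open Scope classical_set_scope.
Local Open Scope ring_scope.
Set Implicit Arguments. Unset Strict Implicit. Unset Printing Implicit Defensive.

(* Lower bound: u = |z^alpha|^(2/mu) is a competitor. Its logarithm is a combination of the
   ln |z_j|^2, hence plurisubharmonic by Jensen's formula on circles, and it is C^2 at a because
   each vanishing factor is |z_j|^(2p) with p >= 1.

   Upper bound: fix k with a_k = 0 and alpha_k = mu. All comparisons take place on complex lines,
   by a maximum principle with majorants that are sums of logarithms. Since u(a) = 0, a
   Liouville-type estimate on lines inside {z_k = 0} gives u = 0 on this hyperplane; being C^2 at
   a, u is then at most C |z_k|^2 near a. A two-constants estimate along lines of constant z_k
   carries this to every other slice as ln u <= (2 - eps) ln |z_k| + O(1). Comparison with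
   2 ln (|z_k| / rho) on the disc |z_k| < rho, where rho^mu prod_(j != k) |z_j|^alpha_j = 1,
   gives u <= |z^alpha|^(2/mu). *)

(** Logarithms of affine functions serve as majorants because Jensen's formula gives their circle
    means exactly, so a small multiple of |p|^2 suffices to make the comparison strict. The obstacle
    is that D_alpha omits the hyperplanes z_j = 0 with alpha_j < 0: a complex line leaves the domain
    near finitely many parameters. The terms with - ln q_i pay for these holes, being large on their
    rims and arbitrarily cheap at the target point. Away from the holes a line in {z_k = 0} never
    leaves D_alpha, since z^alpha = 0 there, and a line with small constant z_k stays in it up to
    any prescribed radius; this room is what a Liouville argument needs. The cost is a factor 1 - d,
    the origin of the loss eps, which disappears only at the end when the exponent tends to 2. Every
    k with alpha_k > 0 and a_k = 0 yields the bound |z^alpha|^(1/alpha_k); as |z^alpha| < 1, the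
    least alpha_k yields the best one. That same minimality gives the exponents p = alpha_j / mu >=
    1 of the lower bound. *)

(** * Integrals over a period and the mean of ln |1 + z| on a circle *)

Section circle_mean.
Context {R : realType}.
Implicit Types (f g : R -> R) (u v : R -> \bar R) (a b c r t : R).

Notation leb := (@lebesgue_measure R).

Definition circle_mean u : \bar R :=
  (((2 * pi)^-1)%:E * \int[leb]_(th in `[0%R, (2 * pi)%R]) u th)%E.

(** The integral is a difference of suprema over simple functions below the positive and the
    negative part, and each of them is monotone without any measurability. Slices of [u] can thus be
    compared directly. *)
Lemma le_integral_pointwise (D : set R) u v : (forall x, D x -> (u x <= v x)%E) ->
  (\int[leb]_(x in D) u x <= \int[leb]_(x in D) v x)%E.
Proof.
move=> uv.
have uv' x : ((u \_ D) x <= (v \_ D) x)%E.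
  by rewrite /patch; case: ifPn => // /set_mem /uv.
rewrite /integral; apply: leeB; apply: le_ereal_sup => _ [h /= hle <-]; exists h => //= x.
- by apply: (le_trans (hle x)); rewrite !funeposE ge_max !le_max uv' lexx orbT.
- by apply: (le_trans (hle x)); rewrite !funenegE ge_max !le_max leeN2 uv' lexx orbT.
Qed.

Lemma le_circle_mean u v : (forall th, (u th <= v th)%E) -> (circle_mean u <= circle_mean v)%E.
Proof.
move=> uv; apply: lee_wpmul2l; last exact: le_integral_pointwise.
by rewrite lee_fin invr_ge0 mulr_ge0 // pi_ge0.
Qed.

Lemma continuous_integrable_itv g a b : continuous g ->
  leb.-integrable `[a, b] (EFin \o g).
Proof.
move=> cg; apply: continuous_compact_integrable; first exact: segment_compact.
exact: continuous_subspaceT.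
Qed.

Definition itv_integral g a b := \int[leb]_(x in `[a, b]) g x.

Lemma itv_integralD f g a b : continuous f -> continuous g ->
  itv_integral (fun x => f x + g x) a b = itv_integral f a b + itv_integral g a b.
Proof. by move=> cf cg; rewrite /itv_integral RintegralD//; exact: continuous_integrable_itv. Qed.

Lemma itv_integralZ c g a b : continuous g -> itv_integral (fun x => c * g x) a b = c *
    itv_integral g a b.
Proof. by move=> cg; rewrite /itv_integral RintegralZl//; exact: continuous_integrable_itv. Qed.

Lemma itv_integral_cst c a b : a <= b -> itv_integral (fun=> c) a b = c * (b - a).
Proof.
move=> ab; rewrite /itv_integral Rintegral_cst//.
congr (_ * _); transitivity (fine (b - a)%:E); last by [].
congr fine; apply: (etrans (lebesgue_measure_itv `[a, b])); rewrite /= lte_fin.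
case: ltP => [//|ba]; have -> : b = a by apply/eqP; rewrite eq_le ba ab.
by rewrite subrr.
Qed.

Lemma itv_integral_cat g a b c : continuous g -> a <= b -> b <= c ->
  itv_integral g a c = itv_integral g a b + itv_integral g b c.
Proof.
move=> cg ab bc.
have := @Rintegral_itvB R g (BLeft a) (BRight c) b (continuous_integrable_itv a c cg).
rewrite !bnd_simp => /(_ ab bc) h.
have : \int[leb]_(x in `]b, c]) g x = itv_integral g b c.
  by rewrite /itv_integral -Rintegral_itv_obnd_cbnd//; apply: integrableS
      (continuous_integrable_itv b c cg) => //; apply: subset_itvr; rewrite bnd_simp.
by rewrite -h => <-; rewrite /itv_integral addrC subrK.
Qed.

Lemma le_itv_integral f g a b : continuous f -> continuous g -> (forall x, f x <= g x) ->
  itv_integral f a b <= itv_integral g a b.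
Proof. by move=> cf cg fg; apply: le_Rintegral => //; exact: continuous_integrable_itv. Qed.

Lemma itv_integral_affine g k c a b : continuous g -> 0 < k -> a <= b ->
  k * itv_integral (fun x => g (k * x + c)) a b = itv_integral g (k * a + c) (k * b + c).
Proof.
move=> cg k0 ab.
have der (x : R) : is_derive x 1 (fun x : R => k * x + c) k.
  by apply: is_derive_eq; rewrite /GRing.scale /= ?mulr1 ?addr0.
have dE : (fun x : R => k * x + c)^`()%classic = cst k.
  by apply/funext => x; rewrite derive1E derive_val.
have cl : continuous (fun x : R => k * x + c).
  by move=> x; apply/differentiable_continuous/derivable1_diffP; exact: ex_derive.
have := @integration_by_substitution_increasing R (fun x => k * x + c) g a b ab.
rewrite dE => sub; rewrite -itv_integralZ; last by move=> x; exact: (continuous_comp (cl x) (cg _)).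
rewrite /itv_integral /Rintegral; congr fine; apply/esym; rewrite sub.
- by apply: eq_integral => x _ /=; rewrite mulrC.
- by move=> x y _ _ xy; rewrite ltrD2r ltr_pM2l.
- by move=> x _; exact: cst_continuous.
- exact: is_cvg_cst.
- exact: is_cvg_cst.
- split; first by move=> x _; exact: ex_derive.
  + by apply: cvg_at_right_filter; exact: cl.
  + by apply: cvg_at_left_filter; exact: cl.
- exact: continuous_subspaceT.
Qed.

Lemma pi2_ge0 : 0 <= 2 * pi :> R. Proof. by rewrite mulr_ge0 // pi_ge0. Qed.

Lemma itv_integral_period g : continuous g -> (forall x, g (x + 2 * pi) = g x) ->
  forall a, itv_integral g a (a + 2 * pi) = itv_integral g 0 (2 * pi).
Proof.
move=> cg pg.
have sh b d : b <= d -> itv_integral g (b + 2 * pi) (d + 2 * pi) = itv_integral g b d.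
  move=> bd; have := itv_integral_affine (2 * pi) cg ltr01 bd; rewrite !mul1r => <-.
  by apply: eq_Rintegral => x _; rewrite mul1r pg.
have p0 := pi2_ge0.
have wl a b : a <= b -> b <= a + 2 * pi ->itv_integral g a (a + 2 * pi) = itv_integral g b (b + 2 *
    pi).
  move=> ab ba; rewrite (@itv_integral_cat g a b)// (@itv_integral_cat g b (a + 2 * pi) (b + 2 *
      pi))// ?lerD2r//.
  by rewrite addrC sh.
have wn (n : nat) a : itv_integral g a (a + 2 * pi) = itv_integral g (a + n%:R * (2 * pi)) (a +
    n%:R * (2 * pi) + 2 * pi).
  elim: n => [|n ->]; first by rewrite mul0r addr0.
  have -> : a + n.+1%:R * (2 * pi) = a + n%:R * (2 * pi) + 2 * pi by rewrite -natr1; ring.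
  by rewrite sh// lerDl.
have bnd a : 0 <= a -> itv_integral g a (a + 2 * pi) = itv_integral g 0 (2 * pi).
  move=> a0; have pp : 0 < 2 * pi :> R by rewrite mulr_gt0// pi_gt0.
  have /truncn_itv : 0 <= a / (2 * pi) by rewrite divr_ge0.
  set n := Num.truncn _ => /andP[n1 n2].
  rewrite -[in RHS](add0r (2 * pi)) (wn n 0) add0r; apply/esym/wl.
    by rewrite -ler_pdivlMr.
  by move: n2; rewrite -natr1 ltr_pdivrMr// mulrDl mul1r; lra.
move=> a; have [a0|a0] := leP 0 a; first exact: bnd.
have pp : 0 < 2 * pi :> R by rewrite mulr_gt0// pi_gt0.
rewrite (wn (Num.truncn (- a / (2 * pi))).+1); apply: bnd.
have /truncn_itv : 0 <= - a / (2 * pi) by rewrite divr_ge0// oppr_ge0 ltW.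
by rewrite ltr_pdivrMr// => /andP[_]; lra.
Qed.

(* |1 + (b - i c) exp(i x)|^2 *)
Definition gsq b c x := 1 + b ^+ 2 + c ^+ 2 + 2 * b * cos x + 2 * c * sin x.

(** By Cauchy-Schwarz, |b cos x + c sin x| is at most the square root of b^2 + c^2. *)
Lemma gsq_bounds b c r : b ^+ 2 + c ^+ 2 <= r ^+ 2 -> 0 <= r -> r < 1 ->
  forall x, (1 - r) ^+ 2 <= gsq b c x <= (1 + r) ^+ 2.
Proof.
move=> bcr r0 r1 x; have := cos2Dsin2 x; rewrite /gsq; set C := cos x; set S := sin x => CS.
set m := b ^+ 2 + c ^+ 2 in bcr.
have m0 : 0 <= m by rewrite addr_ge0 ?sqr_ge0.
pose q := Num.sqrt m; have q0 : 0 <= q by exact: sqrtr_ge0.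
have q2 : q ^+ 2 = m by rewrite sqr_sqrtr.
have qr : q <= r by rewrite -(@ler_sqr _ q r)// ?nnegrE// q2.
have : `|b * C + c * S| <= q.
  rewrite -(@ler_sqr _ _ q) ?nnegrE// real_normK ?num_real// q2 /m.
  have := sqr_ge0 (b * S - c * C); nra.
rewrite ler_norml => /andP[l1 l2].
by apply/andP; split; rewrite /m in q2; nra.
Qed.

Lemma continuous_gsq b c : continuous (gsq b c).
Proof.
move=> x; apply: cvgD; last by apply: cvgM; [exact: cvg_cst|exact: continuous_sin].
apply: cvgD; first exact: cvg_cst.
by apply: cvgM; [exact: cvg_cst|exact: continuous_cos].
Qed.

Lemma continuous_ln_comp g : continuous g -> (forall x, 0 < g x) -> continuous (fun x => ln (g x)).
Proof. by move=> cg g0 x; apply: (continuous_comp (cg x)); exact: continuous_ln. Qed.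

Lemma itv_integral_double g : continuous g -> (forall x, g (x + 2 * pi) = g x) ->
  itv_integral (fun x => g (2 * x)) 0 (2 * pi) = itv_integral g 0 (2 * pi).
Proof.
move=> cg pg; have p0 := pi2_ge0.
have := itv_integral_affine 0 cg (ltr0n _ 2) p0; rewrite mulr0 !addr0.
rewrite (_ : itv_integral (fun x => g (2 * x + 0)) 0 _ = itv_integral (fun x => g (2 * x)) 0 (2 *
    pi)); last first.
  by apply: eq_Rintegral => x _; rewrite addr0.
rewrite (@itv_integral_cat g 0 (2 * pi) (2 * (2 * pi)))//; last by lra.
have -> : 2 * (2 * pi) = 2 * pi + 2 * pi :> R by ring.
by rewrite itv_integral_period//; lra.
Qed.

Lemma itv_integral_shift_pi g : continuous g -> (forall x, g (x + 2 * pi) = g x) ->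
  itv_integral (fun x => g (x + pi)) 0 (2 * pi) = itv_integral g 0 (2 * pi).
Proof.
move=> cg pg; have p0 := pi2_ge0.
have := itv_integral_affine pi cg ltr01 p0; rewrite mulr0 add0r !mul1r (addrC _ pi).
rewrite (itv_integral_period cg pg) => <-.
by apply: eq_Rintegral => x _; rewrite mul1r.
Qed.

(* |1 + z| |1 - z| = |1 - z^2| on the circle |z| = |b + i c|: twice the mean of
   ln |1 + z| is the mean of ln |1 - z^2|, and iterating shows that it vanishes. *)
Lemma itv_integral_ln_gsq b c : b ^+ 2 + c ^+ 2 < 1 -> itv_integral (fun x => ln (gsq b c x)) 0 (2
    * pi) = 0.
Proof.
move=> bc1; set m := b ^+ 2 + c ^+ 2 in bc1.
have m0 : 0 <= m by rewrite addr_ge0 ?sqr_ge0.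
pose r := Num.sqrt m; have r0 : 0 <= r by exact: sqrtr_ge0.
have r2 : r ^+ 2 = m by rewrite sqr_sqrtr.
have r1 : r < 1 by rewrite -(@ltr_sqr _ r 1) ?nnegrE// r2 expr1n.
have pos b' c' : b' ^+ 2 + c' ^+ 2 <= r ^+ 2 -> forall x, 0 < gsq b' c' x.
  move=> h x; have /andP[+ _] := gsq_bounds h r0 r1 x; apply: lt_le_trans.
  by rewrite exprn_gt0// subr_gt0.
have cln b' c' : b' ^+ 2 + c' ^+ 2 <= r ^+ 2 -> continuous (fun x => ln (gsq b' c' x)).
  by move=> h; apply: continuous_ln_comp; [exact: continuous_gsq|exact: pos].
have p0 := pi2_ge0.
(* One bound for the whole disc of radius r, hence for all iterates of the halving step. *)
pose M := (`|ln ((1 - r) ^+ 2)| + `|ln ((1 + r) ^+ 2)|) * (2 * pi).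
have bd b' c' : b' ^+ 2 + c' ^+ 2 <= r ^+ 2 -> `|itv_integral (fun x => ln (gsq b' c' x)) 0 (2 *
    pi)| <= M.
  move=> h; rewrite /M; set N := _ + _.
  have := itv_integral_cst N p0; have := itv_integral_cst (- N) p0; rewrite ler_norml subr0 mulNr
      => <- <-.
  have l1 : 0 < (1 - r) ^+ 2 by rewrite exprn_gt0// subr_gt0.
  have l2 : 0 < (1 + r) ^+ 2 by rewrite exprn_gt0//; lra.
  have lb x : ln ((1 - r) ^+ 2) <= ln (gsq b' c' x) <= ln ((1 + r) ^+ 2).
    have /andP[h1 h2] := gsq_bounds h r0 r1 x.
    by rewrite !ler_ln ?posrE ?h1 ?h2//; exact: pos.
  have n1 := ler_norm (ln ((1 + r) ^+ 2)); have n2 := lerNnormlW (lexx `|ln ((1 - r) ^+ 2)|).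
  have n3 := normr_ge0 (ln ((1 + r) ^+ 2)); have n4 := normr_ge0 (ln ((1 - r) ^+ 2)).
  rewrite /N; apply/andP; split; apply: le_itv_integral; try (by move=> x; exact: cvg_cst); try
      exact: cln.
  - by move=> x; have /andP[] := lb x; lra.
  - by move=> x; have /andP[] := lb x; lra.
(* The new pair belongs to - z^2, because (b - i c)^2 = b^2 - c^2 - 2 i b c, and x + pi in place of
   x turns z into - z. The pair stays in the disc of radius r since r < 1, so the step can be
   iterated. *)
have half b' c' : b' ^+ 2 + c' ^+ 2 <= r ^+ 2 ->
    (- (b' ^+ 2 - c' ^+ 2)) ^+ 2 + (- 2 * b' * c') ^+ 2 <= r ^+ 2 /\
    itv_integral (fun x => ln (gsq b' c' x)) 0 (2 * pi) =
    2^-1 * itv_integral (fun x => ln (gsq (- (b' ^+ 2 - c' ^+ 2)) (- 2 * b' * c') x)) 0 (2 * pi).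
  move=> h; have h' : (- (b' ^+ 2 - c' ^+ 2)) ^+ 2 + (- 2 * b' * c') ^+ 2 <= r ^+ 2.
    have -> : (- (b' ^+ 2 - c' ^+ 2)) ^+ 2 + (- 2 * b' * c') ^+ 2 = (b' ^+ 2 + c' ^+ 2) ^+ 2 by
        ring.
    have : 0 <= b' ^+ 2 + c' ^+ 2 by rewrite addr_ge0 ?sqr_ge0.
    have : r ^+ 2 <= 1 by rewrite expr_le1//; lra.
    by nra.
  split=> //.
  have pgsq b1 c1 x : ln (gsq b1 c1 (x + 2 * pi)) = ln (gsq b1 c1 x).
    by rewrite /gsq (_ : 2 * pi = pi *+ 2) ?cosD2pi ?sinD2pi// mulr_natl.
  rewrite -[in RHS]itv_integral_double//; [|exact: cln].
  rewrite (_ : itv_integral (fun x => ln (gsq (- _) _ (2 * x))) _ _ =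
     itv_integral (fun x => ln (gsq b' c' x) + ln (gsq b' c' (x + pi))) 0 (2 * pi)); last first.
    apply: eq_Rintegral => x _; rewrite -lnM ?posrE ?pos//; congr ln.
    rewrite /gsq cosDpi sinDpi (_ : 2 * x = x *+ 2); last by rewrite mulr_natl.
    rewrite cos_mulr2n sin_mulr2n -mulr_natl; have := cos2Dsin2 x.
    move: (cos x) (sin x) => C S CS; apply/eqP; rewrite -subr_eq0.
    rewrite [X in X == 0](_ : _ = 4 * c' ^+ 2 * (C ^+ 2 + S ^+ 2 - 1)); last by ring.
    by rewrite CS subrr mulr0.
  rewrite itv_integralD; [|exact: cln|]; last first.
    move=> x; apply: (@continuous_comp _ _ _ (fun x => x + pi) (fun x => ln (gsq b' c' x))).
      by apply: cvgD; [exact: cvg_id|exact: cvg_cst].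
    exact: cln.
  by rewrite (itv_integral_shift_pi (cln _ _ h) (pgsq _ _)); lra.
have it (n : nat) : forall b' c', b' ^+ 2 + c' ^+ 2 <= r ^+ 2 -> `|itv_integral (fun x => ln (gsq
    b' c' x)) 0 (2 * pi)| <= 2^-1 ^+ n * M.
  elim: n => [|n IH] b' c' h; first by rewrite mul1r bd.
  have [h' ->] := half _ _ h; rewrite normrM (exprS 2^-1 n) -(mulrA 2^-1) ger0_norm// ler_wpM2l//.
  exact: IH.
have Kb := it ^~ b ^~ c.
apply/eqP; rewrite -normr_le0; apply/ler_addgt0Pr => e e0; rewrite add0r.
have M0 : 0 <= M by rewrite mulr_ge0// addr_ge0.
have : 2^-1 ^+ n * M @[n --> \oo] --> (0 : R).
  rewrite -(mul0r M); apply: cvgM; last exact: cvg_cst.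
  by apply: cvg_expr; rewrite ger0_norm// invf_lt1// ltr1n.
move=> /cvgr0Pnorm_lt /(_ e e0) [N _ /(_ N (leqnn N))] /=.
move=> /(le_lt_trans (ler_norm _)) /ltW; apply: le_trans; apply: it.
by rewrite r2.
Qed.

End circle_mean.

(** * Jensen's formula for affine functions *)

Section log_means.
Context {R : realType}.
Implicit Types (x y u v s t r b c D e : R) (f g : R -> R).

Notation mean := (@circle_mean R).

Lemma circle_meanE g : continuous g ->
  mean (fun th => (g th)%:E) = ((2 * pi)^-1 * itv_integral g 0 (2 * pi))%:E.
Proof.
move=> cg; rewrite /circle_mean /itv_integral /Rintegral EFinM fineK//.
by apply: integrable_fin_num => //; exact: continuous_integrable_itv.
Qed.

Lemma continuous_bigsum (I : Type) (l : seq I) (T : topologicalType) (g : I -> T -> R) :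
  (forall i, continuous (g i)) -> continuous (fun p => \sum_(i <- l) g i p).
Proof.
move=> cg; elim: l => [|i l IH] p.
  rewrite (_ : (fun p => _) = cst 0); first exact: cst_continuous.
  by apply/funext => q; rewrite big_nil.
rewrite (_ : (fun p => _) = g i \+ (fun p => \sum_(j <- l) g j p)); last first.
  by apply/funext => q; rewrite big_cons.
by apply: cvgD; [exact: cg|exact: IH].
Qed.

Lemma itv_integral_sum (I : Type) (l : seq I) (g : I -> R -> R) a b :
  (forall i, continuous (g i)) -> a <= b ->
  itv_integral (fun th => \sum_(i <- l) g i th) a b = \sum_(i <- l) itv_integral (g i) a b.
Proof.
move=> cg ab; elim: l => [|i l IH].
  rewrite big_nil; transitivity (itv_integral (fun=> 0 : R) a b); last by rewrite
      itv_integral_cst// mul0r.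
  by apply: eq_Rintegral => th _; rewrite big_nil.
rewrite big_cons -IH -itv_integralD//; last exact: continuous_bigsum.
by apply: eq_Rintegral => th _; rewrite big_cons.
Qed.

(* the squared modulus of (x + i y) + (s + i t) (u + i v) *)
Definition sqm x y u v s t := (x + s * u - t * v) ^+ 2 + (y + s * v + t * u) ^+ 2.

Lemma sqm_ge0 x y u v s t : 0 <= sqm x y u v s t.
Proof. by rewrite addr_ge0 ?sqr_ge0. Qed.

Lemma sqm_shift x y u v s0 t0 s t : sqm x y u v (s0 + s) (t0 + t) =
  sqm (x + s0 * u - t0 * v) (y + s0 * v + t0 * u) u v s t.
Proof. by rewrite /sqm; congr (_ ^+ 2 + _ ^+ 2); ring. Qed.

Lemma sqm0 x y u v : sqm x y u v 0 0 = x ^+ 2 + y ^+ 2.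
Proof. by rewrite /sqm !mul0r !addr0 subr0. Qed.

Lemma continuous_circle s t x y u v r : continuous (fun th => sqm x y u v (s + r * cos th) (t + r *
    sin th)).
Proof.
have cc k l : continuous (fun th : R => k + l * cos th).
  by move=> th; apply: cvgD; [exact: cvg_cst|apply: cvgM; [exact: cvg_cst|exact: continuous_cos]].
have cs k l : continuous (fun th : R => k + l * sin th).
  by move=> th; apply: cvgD; [exact: cvg_cst|apply: cvgM; [exact: cvg_cst|exact: continuous_sin]].
move=> th; rewrite /sqm; apply: cvgD; rewrite !expr2.
  by apply: cvgM; (apply: cvgB; [apply: cvgD; [exact: cvg_cst|apply: cvgM; [exact: cc|exact:
      cvg_cst]]
     |apply: cvgM; [exact: cs|exact: cvg_cst]]).
by apply: cvgM; (apply: cvgD; [apply: cvgD; [exact: cvg_cst|apply: cvgM; [exact: cc|exact: cvg_cst]]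
     |apply: cvgM; [exact: cs|exact: cvg_cst]]).
Qed.

Lemma itv_integral_ln_scaled_gsq D b c : 0 < D -> b ^+ 2 + c ^+ 2 < 1 ->
  itv_integral (fun th => ln (D * gsq b c th)) 0 (2 * pi) = 2 * pi * ln D.
Proof.
move=> D0 bc1; have p0 := @pi2_ge0 R.
have g0 th : 0 < gsq b c th.
  have m0 : 0 <= b ^+ 2 + c ^+ 2 by rewrite addr_ge0 ?sqr_ge0.
  have s1 : Num.sqrt (b ^+ 2 + c ^+ 2) < 1.
    by rewrite -(@ltr_sqr _ _ 1) ?nnegrE ?sqrtr_ge0// sqr_sqrtr// expr1n.
  have s2 : b ^+ 2 + c ^+ 2 <= Num.sqrt (b ^+ 2 + c ^+ 2) ^+ 2 by rewrite sqr_sqrtr.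
  have /andP[+ _] := gsq_bounds s2 (sqrtr_ge0 _) s1 th.
  by apply: lt_le_trans; rewrite exprn_gt0// subr_gt0.
rewrite (_ : itv_integral _ _ _ = itv_integral (fun th => ln D + ln (gsq b c th)) 0 (2 * pi)); last
    first.
  by apply: eq_Rintegral => th _; rewrite lnM ?posrE.
rewrite itv_integralD; [|by move=> ?; exact: cvg_cst|by apply: continuous_ln_comp => //; exact:
    continuous_gsq].
by rewrite itv_integral_ln_gsq// itv_integral_cst// addr0 subr0 mulrC.
Qed.

(** Division by the value X + i Y at the centre gives P |1 + (b - i c) exp(i th)|^2 with b - i c = r
    (u + i v) / (X + i Y); the hypothesis says that this quotient has modulus below 1. *)
Lemma mean_ln_sqm x y u v s t r : r ^+ 2 * (u ^+ 2 + v ^+ 2) < sqm x y u v s t ->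
  itv_integral (fun th => ln (sqm x y u v (s + r * cos th) (t + r * sin th))) 0 (2 * pi) =
  2 * pi * ln (sqm x y u v s t).
Proof.
set P := sqm x y u v s t => PW; have P0 : 0 < P.
  by apply: le_lt_trans PW; rewrite mulr_ge0 ?sqr_ge0// addr_ge0 ?sqr_ge0.
set X := x + s * u - t * v; set Y := y + s * v + t * u.
have PE : P = X ^+ 2 + Y ^+ 2 by [].
rewrite -(@itv_integral_ln_scaled_gsq P (r * (X * u + Y * v) / P) (r * (Y * u - X * v) / P))//.
  apply: eq_Rintegral => th _; congr ln; rewrite sqm_shift -/X -/Y /gsq /sqm.
  have P0' : P != 0 by rewrite gt_eqF.
  have := cos2Dsin2 th; move: (cos th) (sin th) => C S CS.
  have -> : P * (1 + (r * (X * u + Y * v) / P) ^+ 2 + (r * (Y * u - X * v) / P) ^+ 2 +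
     2 * (r * (X * u + Y * v) / P) * C + 2 * (r * (Y * u - X * v) / P) * S) =
     P + (r ^+ 2 * (u ^+ 2 + v ^+ 2)) * (X ^+ 2 + Y ^+ 2) / P + 2 * (r * (X * u + Y * v)) * C + 2 *
         (r * (Y * u - X * v)) * S.
    by field.
  rewrite -PE mulfK// PE; apply/eqP; rewrite -subr_eq0.
  rewrite [X in X == 0](_ : _ = r ^+ 2 * (u ^+ 2 + v ^+ 2) * (C ^+ 2 + S ^+ 2 - 1)); last by ring.
  by rewrite CS subrr mulr0.
rewrite (_ : _ + _ = (r ^+ 2 * (u ^+ 2 + v ^+ 2)) * (X ^+ 2 + Y ^+ 2) / P ^+ 2); last first.
  by field; rewrite gt_eqF.
by rewrite -PE expr2 invfM mulrA mulfK ?gt_eqF// ltr_pdivrMr// mul1r.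
Qed.

(** If the inequality failed, the zero - (X + i Y) / (u + i v) of the affine function would lie in
    the disc. *)
Lemma sqm_disc_nonvanishing x y u v s t r : 0 <= r ->
  (forall s' t', s' ^+ 2 + t' ^+ 2 <= r ^+ 2 -> sqm x y u v (s + s') (t + t') != 0) ->
  r ^+ 2 * (u ^+ 2 + v ^+ 2) < sqm x y u v s t.
Proof.
move=> r0 nz; set P := sqm x y u v s t; set W := u ^+ 2 + v ^+ 2.
have P0 : 0 < P.
  rewrite lt_neqAle sqm_ge0 andbT eq_sym; have := nz 0 0; rewrite !addr0; apply.
  by rewrite expr0n/= addr0 sqr_ge0.
have W0 : 0 <= W by rewrite addr_ge0 ?sqr_ge0.
have [WE|Wn] := eqVneq W 0; first by rewrite WE mulr0.
have {W0 Wn}Wp : 0 < W by rewrite lt_neqAle eq_sym Wn.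
rewrite ltNge; apply/negP => PW.
set X := x + s * u - t * v; set Y := y + s * v + t * u.
have WE : u ^+ 2 + v ^+ 2 = W by [].
have W0 : W != 0 by rewrite gt_eqF.
have : sqm x y u v (s + - (X * u + Y * v) / W) (t + - (Y * u - X * v) / W) != 0.
  apply: nz.
  rewrite (_ : _ + _ = P * (u ^+ 2 + v ^+ 2) / W ^+ 2); last by rewrite /P /sqm -/X -/Y; field.
  by rewrite WE expr2 invfM mulrA mulfK// ler_pdivrMr.
move/eqP; apply; rewrite sqm_shift -/X -/Y /sqm.
rewrite (_ : X + _ * u - _ * v = X * (W - (u ^+ 2 + v ^+ 2)) / W); last by field.
rewrite (_ : Y + _ * v + _ * u = Y * (W - (u ^+ 2 + v ^+ 2)) / W); last by field.
by rewrite WE subrr !mulr0 !mul0r expr0n addr0.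
Qed.

(** On the circle the argument of the logarithm is A + 2 B cos th + 2 C sin th with B^2 + C^2 = P W.
    It equals D |1 + (B/D - i C/D) exp(i th)|^2 when D^2 - A D + P W = 0; for the larger root D the
    mean is exactly ln D, and D >= P. Thanks to e > 0 zeros inside or on the circle are allowed. *)
Lemma mean_ln_sqmD_ge x y u v s t r e : 0 < e -> 0 < sqm x y u v s t ->
  2 * pi * ln (sqm x y u v s t) <=
  itv_integral (fun th => ln (sqm x y u v (s + r * cos th) (t + r * sin th) + e)) 0 (2 * pi).
Proof.
set P := sqm x y u v s t => e0 P0; have p0 := @pi2_ge0 R.
set X := x + s * u - t * v; set Y := y + s * v + t * u.
have PE : P = X ^+ 2 + Y ^+ 2 by [].
set W := r ^+ 2 * (u ^+ 2 + v ^+ 2); have W0 : 0 <= W.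
  by rewrite mulr_ge0 ?sqr_ge0// addr_ge0 ?sqr_ge0.
pose B := r * (X * u + Y * v); pose C := r * (Y * u - X * v).
have BC : B ^+ 2 + C ^+ 2 = P * W by rewrite PE /B /C /W; ring.
(* S is the square root of the discriminant, at least |P - W|; hence D = (A + S) / 2 >= P. *)
pose A := P + W + e; pose S := Num.sqrt (A ^+ 2 - 4 * (P * W)).
have D0 : (P - W) ^+ 2 <= A ^+ 2 - 4 * (P * W) by rewrite /A; nra.
have S0 : 0 <= S := sqrtr_ge0 _.
have S2 : S ^+ 2 = A ^+ 2 - 4 * (P * W).
  by rewrite sqr_sqrtr// (le_trans _ D0)// sqr_ge0.
have SPW : P - W <= S.
  have [h|h] := leP (P - W) 0; first exact: le_trans h S0.
  by rewrite -(@ler_sqr _ _ S) ?nnegrE ?(ltW h)// S2.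
pose D := (A + S) / 2; have DP : P <= D by rewrite /D ler_pdivlMr//; rewrite /A; lra.
have Dp : 0 < D by exact: lt_le_trans DP.
have D2 : D ^+ 2 + P * W = A * D.
  by rewrite /D; move: S2; rewrite /A; set a := P + W + e; nra.
have DW : P * W < D ^+ 2.
  have : 0 < A - S \/ A - S <= 0 by case: (ltP 0 (A - S)); [left|right].
  have : 2 * D = A + S by rewrite /D; field.
  have : P + W < A by rewrite /A; lra.
  by rewrite /A in S2 D2 *; nra.
rewrite (_ : itv_integral _ _ _ = 2 * pi * ln D).
  by rewrite ler_wpM2l// ler_ln ?posrE.
rewrite -(@itv_integral_ln_scaled_gsq D (B / D) (C / D))//; last first.
  have Dn : D != 0 by rewrite gt_eqF.
  have -> : (B / D) ^+ 2 + (C / D) ^+ 2 = P * W / D ^+ 2 by rewrite -BC; field.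
  by rewrite ltr_pdivrMr ?exprn_gt0// mul1r.
apply: eq_Rintegral => th _; congr ln; rewrite sqm_shift -/X -/Y /gsq /sqm.
have Dn : D != 0 by rewrite gt_eqF.
have := cos2Dsin2 th; move: (cos th) (sin th) => Co Si CS.
have -> : D * (1 + (B / D) ^+ 2 + (C / D) ^+ 2 + 2 * (B / D) * Co + 2 * (C / D) * Si) =
  (D ^+ 2 + (B ^+ 2 + C ^+ 2)) / D + 2 * B * Co + 2 * C * Si by field.
rewrite BC D2 mulfK// /A PE; apply/eqP; rewrite -subr_eq0.
rewrite [X in X == 0](_ : _ = W * (Co ^+ 2 + Si ^+ 2 - 1)); last by rewrite /B /C /W; ring.
by rewrite CS subrr mulr0.
Qed.

(** The excess r^2 over the value at the centre is what makes the maximum principle strict. *)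
Lemma mean_sqnorm s t r :
  itv_integral (fun th => (s + r * cos th) ^+ 2 + (t + r * sin th) ^+ 2) 0 (2 * pi) =
  2 * pi * (s ^+ 2 + t ^+ 2 + r ^+ 2).
Proof.
have p0 := @pi2_ge0 R.
have sh (g : R -> R) : continuous g -> (forall th, g (th + pi) = - g th) ->
    itv_integral g 0 (2 * pi) = 0.
  move=> cg gp; have per th : g (th + 2 * pi) = g th.
    by rewrite (_ : th + 2 * pi = th + pi + pi); [rewrite !gp opprK|ring].
  have := itv_integral_shift_pi cg per; rewrite (_ : itv_integral _ _ _ = - 1 * itv_integral g 0 (2
      * pi)); first by lra.
  by rewrite -itv_integralZ//; apply: eq_Rintegral => th _; rewrite gp mulN1r.
have ic : itv_integral cos 0 (2 * pi) = 0 :> R by apply: sh; [exact: continuous_cos|exact: cosDpi].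
have isn : itv_integral sin 0 (2 * pi) = 0 :> R by apply: sh; [exact: continuous_sin|exact: sinDpi].
rewrite (_ : itv_integral _ _ _ = itv_integral (fun th => (s ^+ 2 + t ^+ 2 + r ^+ 2) + (2 * s * r *
    cos th + 2 * t * r * sin th)) 0 (2 * pi)); last first.
  apply: eq_Rintegral => th _; have := cos2Dsin2 th; move: (cos th) (sin th) => C S CS.
  apply/eqP; rewrite -subr_eq0 [X in X == 0](_ : _ = r ^+ 2 * (C ^+ 2 + S ^+ 2 - 1)); last by ring.
  by rewrite CS subrr mulr0.
have c1 : continuous (fun th : R => 2 * s * r * cos th).
  by move=> th; apply: cvgM; [exact: cvg_cst|exact: continuous_cos].
have c2 : continuous (fun th : R => 2 * t * r * sin th).
  by move=> th; apply: cvgM; [exact: cvg_cst|exact: continuous_sin].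
rewrite itv_integralD; [|by move=> ?; exact: cvg_cst|by move=> th; apply: cvgD; [exact: c1|exact:
    c2]].
rewrite (itv_integralD _ _ c1 c2) (itv_integralZ _ _ _ (@continuous_cos R)) (itv_integralZ _ _ _
    (@continuous_sin R)).
by rewrite ic isn itv_integral_cst//; ring.
Qed.

End log_means.

(** * Upper semicontinuity and the maximum principle with logarithmic majorants *)

Section maximum_principle.
Context {R : realType}.
Implicit Types (s t r : R) (f : R * R -> \bar R).

Definition usc_on (T : topologicalType) (K : set T) (F : T -> \bar R) :=
  forall p, K p -> forall c : R, (F p < c%:E)%E -> \forall q \near p, (F q < c%:E)%E.

Lemma lte_between_real (a b : \bar R) : (a < b)%E ->
  exists2 c : R, (a < c%:E)%E & (c%:E < b)%E.
Proof.
case: a => [r||]; case: b => [m||]//=.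
- by rewrite lte_fin => rm; exists ((r + m) / 2); rewrite lte_fin; [rewrite ltr_pdivlMr|rewrite
    ltr_pdivrMr]; lra.
- by move=> _; exists (r + 1); rewrite ?ltry// lte_fin ltrDl.
- by move=> _; exists (m - 1); rewrite ?ltNyr// lte_fin gtrBl.
- by move=> _; exists 0; rewrite ?ltNyr ?ltry.
Qed.

(** If the supremum M were not attained, the sets where F < i would cover K as i increases to M. By
    compactness a single i < M would do, contradicting the choice of M. *)
Lemma usc_attains_max (T : topologicalType) (K : set T) (F : T -> \bar R) :
  compact K -> K !=set0 -> usc_on K F -> exists2 p, K p & forall q, K q -> (F q <= F p)%E.
Proof.
move=> cK [p0 Kp0] uscF; pose M := ereal_sup (F @` K).
have FM q : K q -> (F q <= M)%E by move=> Kq; apply: ereal_sup_ubound; exists q.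
have [[p Kp FpM]|nat_max] := pselect (exists2 p, K p & F p = M).
  by exists p => // q Kq; rewrite FpM FM.
have ltM p : K p -> (F p < M)%E.
  by move=> Kp; rewrite lt_neqAle FM// andbT; apply/eqP => FpM; apply: nat_max; exists p.
(* A filter for [i] tending to M from below, uniform in whether M is real or +oo. *)
have Gfilter : exists G : set_system R, [/\ ProperFilter G,
    forall c : R, (c%:E < M)%E -> \forall i \near G, c <= i &
    \forall i \near G, (i%:E < M)%E].
  case: M ltM {FM nat_max} => [r||] ltM.
  - exists (r^'-); split.
    + exact: at_left_proper_filter.
    + by move=> c; rewrite lte_fin => cr; exact: nbhs_left_ge.
    + by near=> i; rewrite lte_fin; near: i; exact: nbhs_left_lt.
  - exists (pinfty_nbhs R); split; first exact: proper_pinfty_nbhs.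
    + by move=> c _; apply: nbhs_pinfty_ge; exact: num_real.
    + by near=> i; rewrite ltry.
  - by have := ltM _ Kp0; rewrite ltNge leNye.
have [G [PG Gge Glt]] := Gfilter.
have /compact_near_coveringP cov := cK.
have : \forall i \near G, K `<=` (fun q => (F q < i%:E)%E).
  apply: cov => x Kx.
  have [c Fc cM] := lte_between_real (ltM _ Kx).
  near=> z i => /=.
  apply: (@lt_le_trans _ _ c%:E); first by near: z; exact: uscF.
  by rewrite lee_fin; near: i; exact: Gge.
move=> cv; have [i [Ki iM]] := @filter_ex _ _ PG _ (filterI cv Glt).
have : (M <= i%:E)%E by apply: ge_ereal_sup => _ [q Kq <-]; exact/ltW/Ki.
by rewrite leNgt iM.
Unshelve. all: by end_near.
Qed.

Lemma continuous_sqm x y u v : continuous (fun p : R * R => sqm x y u v p.1 p.2).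
Proof.
have l a b c : continuous (fun p : R * R => a + p.1 * b + p.2 * c).
  move=> p; apply: cvgD; first apply: cvgD; first exact: cvg_cst.
    by apply: cvgM; [exact: cvg_fst|exact: cvg_cst].
  by apply: cvgM; [exact: cvg_snd|exact: cvg_cst].
rewrite (_ : (fun p => _) = (fun p : R * R => (x + p.1 * u + p.2 * (- v)) * (x + p.1 * u + p.2 * (-
    v)) + (y + p.1 * v + p.2 * u) * (y + p.1 * v + p.2 * u))); last first.
  by apply/funext => p; rewrite /sqm; ring.
by move=> p; apply: cvgD; apply: cvgM; exact: l.
Qed.

Section domain.
Variables (I : finType) (x y u v c eta : I -> R) (c0 R0 : R).

Let q i (p : R * R) := sqm (x i) (y i) (u i) (v i) p.1 p.2.

(** A closed disc with a hole around the zero of each affine function; for eta > 0 the logarithms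
    are harmonic where it is used. *)
Definition pdisc : set (R * R) :=
  [set p | p.1 ^+ 2 + p.2 ^+ 2 <= R0 /\ forall i, eta i <= q i p].

Definition logsum (p : R * R) := c0 + \sum_i c i * ln (q i p).

Lemma compact_pdisc : compact pdisc.
Proof.
pose B : set (R * R) := `[- (1 + R0), 1 + R0] `*` `[- (1 + R0), 1 + R0].
have cB : compact B by apply: compact_setX; exact: segment_compact.
apply: (subclosed_compact _ cB).
  rewrite (_ : pdisc = (fun p : R * R => sqm 0 0 1 0 p.1 p.2) @^-1` [set r | r <= R0] `&`
     \bigcap_(i in [set: I]) (q i @^-1` [set r | eta i <= r])).
    apply: closedI; first by apply: (closed_comp _ (@closed_le _ R0)) => p _; exact: continuous_sqm.
    by apply: closed_bigI => i _; apply: (closed_comp _ (@closed_ge _ (eta i))) => p _; exact: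
        continuous_sqm.
  apply/seteqP; split=> p /=; rewrite /pdisc /sqm/=.
    by case=> h1 h2; split; [move: h1; rewrite !mulr1 !mulr0 !add0r subr0|by move=> i _; exact: h2].
  by case=> h1 h2; split; [move: h1; rewrite !mulr1 !mulr0 !add0r subr0|by move=> i; exact: h2].
move=> p [pR _]; rewrite /B /=; rewrite !in_itv /=.
have h1 := sqr_ge0 p.1; have h2 := sqr_ge0 p.2.
have b (a : R) : a ^+ 2 <= R0 -> - (1 + R0) <= a <= 1 + R0.
  by move=> aR; rewrite -ler_norml; have := sqr_ge0 (`|a| - 1); have := normr_ge0 a; rewrite
      -(real_normK (num_real a)) in aR *; nra.
by split; apply: b; lra.
Qed.

Hypothesis eta0 : forall i, 0 < eta i.

(** Mean value property of [logsum], with the strict defect d r^2 of the correction term. The disc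
    avoids the zeros of all q i because it lies in [pdisc]. *)
Lemma itv_integral_logsum s t r d : 0 <= r ->
  (forall s' t', s' ^+ 2 + t' ^+ 2 <= r ^+ 2 -> pdisc (s + s', t + t')) ->
  let h := fun th => logsum (s + r * cos th, t + r * sin th) - d * ((s + r * cos th) ^+ 2 + (t + r
      * sin th) ^+ 2) in
  continuous h /\ itv_integral h 0 (2 * pi) = 2 * pi * (logsum (s, t) - d * (s ^+ 2 + t ^+ 2 + r ^+
      2)).
Proof.
move=> r0 disc h.
have oncirc th : (r * cos th) ^+ 2 + (r * sin th) ^+ 2 <= r ^+ 2.
  by rewrite !exprMn -mulrDr cos2Dsin2 mulr1.
have cln i : continuous (fun th => ln (q i (s + r * cos th, t + r * sin th))).
  apply: continuous_ln_comp; first exact: continuous_circle.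
  by move=> th; have [_ /(_ i)] := disc _ _ (oncirc th); exact: lt_le_trans.
have cterm i : continuous (fun th => c i * ln (q i (s + r * cos th, t + r * sin th))).
  by move=> th; apply: cvgM; [exact: cvg_cst|exact: cln].
have csum : continuous (fun th => \sum_i c i * ln (q i (s + r * cos th, t + r * sin th))).
  exact: continuous_bigsum.
have clog : continuous (fun th => logsum (s + r * cos th, t + r * sin th)).
  by move=> th; apply: cvgD; [exact: cvg_cst|exact: csum].
have csq : continuous (fun th => (s + r * cos th) ^+ 2 + (t + r * sin th) ^+ 2).
  rewrite (_ : (fun th => _) = (fun th => sqm 0 0 1 0 (s + r * cos th) (t + r * sin th))).
    exact: continuous_circle.
  by apply/funext => th; rewrite /sqm !mulr1 !mulr0 !add0r subr0.
have csqd : continuous (fun th => - d * ((s + r * cos th) ^+ 2 + (t + r * sin th) ^+ 2)).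
  by move=> th; apply: cvgM; [exact: cvg_cst|exact: csq].
have hE : h = (fun th => logsum (s + r * cos th, t + r * sin th) + - d * ((s + r * cos th) ^+ 2 +
    (t + r * sin th) ^+ 2)).
  by apply/funext => th; rewrite /h mulNr.
split; first by rewrite hE => th; apply: cvgD; [exact: clog|exact: csqd].
have p0 := @pi2_ge0 R.
rewrite hE (itv_integralD _ _ clog csqd) (itv_integralZ _ _ _ csq) mean_sqnorm.
have ccst : continuous (fun _ : R => c0) by move=> ?; exact: cvg_cst.
rewrite /logsum (itv_integralD _ _ ccst csum) (itv_integral_sum _ cterm)// itv_integral_cst//.
rewrite (_ : \sum_i itv_integral _ _ _ = \sum_i 2 * pi * (c i * ln (q i (s, t)))).
  by rewrite -mulr_sumr; ring.
apply: eq_bigr => i _; rewrite (itv_integralZ _ _ _ (cln i)) mean_ln_sqm; first by rewrite mulrCA.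
apply: sqm_disc_nonvanishing => // s' t' h'.
by have [_ /(_ i)] := disc _ _ h'; rewrite /q/= => /(lt_le_trans (eta0 i)); rewrite lt0r => /andP[].
Qed.

Lemma continuous_logsum p : pdisc p -> {for p, continuous logsum}.
Proof.
move=> [_ Kp]; apply: cvgD; first exact: cvg_cst.
pose g i (p : R * R) := c i * ln (q i p).
have cg i : {for p, continuous (g i)}.
  apply: cvgM; first exact: cvg_cst.
  by apply: continuous_comp; [exact: continuous_sqm|apply: continuous_ln; exact: lt_le_trans (Kp
      i)].
rewrite /continuous_at; elim: (index_enum I) => [|i l IH].
  rewrite big_nil (_ : (fun p => _) = cst 0); first exact: cvg_cst.
  by apply/funext => p'; rewrite big_nil.
rewrite big_cons (_ : (fun p => _) = g i \+ (fun p => \sum_(j <- l) g j p)); last first.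
  by apply/funext => p'; rewrite big_cons.
by apply: cvgD; [exact: cg|exact: IH].
Qed.

(** F = f - logsum + d |p|^2 attains its maximum. An interior maximum contradicts the sub-mean
    inequality by d r^2, and on the boundary F <= d R0. Then d tends to 0. *)
Lemma log_maximum_principle f : usc_on pdisc f ->
  (forall p, pdisc p -> (f p <= 0)%E) ->
  (forall s t r, 0 < r ->
     (forall s' t', s' ^+ 2 + t' ^+ 2 <= r ^+ 2 -> pdisc (s + s', t + t')) ->
     (f (s, t) <= circle_mean (fun th : R => f (s + r * cos th, t + r * sin th)%R))%E) ->
  (forall p, pdisc p -> p.1 ^+ 2 + p.2 ^+ 2 = R0 \/ (exists i, q i p = eta i) ->
     (f p <= (logsum p)%:E)%E) ->
  forall p, pdisc p -> (f p <= (logsum p)%:E)%E.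
Proof.
move=> uscf f0 sub bd p0 K0.
have R00 : 0 <= R0 by have [+ _] := K0; apply: le_trans; rewrite addr_ge0 ?sqr_ge0.
suff H d : 0 < d -> (f p0 <= (logsum p0 + d * R0)%:E)%E.
  apply/lee_addgt0Pr => e e0; have R1 : 0 < R0 + 1 by lra.
  apply: (le_trans (H (e / (R0 + 1)) (divr_gt0 e0 R1))).
  rewrite -EFinD lee_fin lerD2l mulrAC ler_pdivrMr//; nra.
move=> d0; pose k (p : R * R) := - logsum p + d * (p.1 ^+ 2 + p.2 ^+ 2).
have csq : continuous (fun p : R * R => p.1 ^+ 2 + p.2 ^+ 2).
  rewrite (_ : (fun p => _) = (fun p : R * R => sqm 0 0 1 0 p.1 p.2)).
    exact: continuous_sqm.
  by apply/funext => p; rewrite /sqm !mulr1 !mulr0 !add0r subr0.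
have ck p : pdisc p -> {for p, continuous k}.
  move=> Kp; apply: cvgD; first by apply: cvgN; exact: continuous_logsum.
  by apply: cvgM; [exact: cvg_cst|exact: csq].
pose F p := (f p + (k p)%:E)%E.
have uscF : usc_on pdisc F.
  move=> p Kp b Fb.
  have : (f p < (b - k p)%:E)%E by rewrite EFinB lteBrDr.
  move=> /lte_between_real[m fm]; rewrite lte_fin => mb.
  have kb : k p < b - m by lra.
  near=> z; rewrite /F (_ : b = m + (b - m)); last by rewrite addrC subrK.
  rewrite (EFinD m); apply: lteD; first by near: z; exact: uscf.
  rewrite lte_fin; near: z; have := ck p Kp.
  by move=> /(@cvgr_lt _ _ _ _ _ (k p)) /(_ _ kb).
have [p Kp Fmax] := usc_attains_max compact_pdisc (ex_intro _ _ K0) uscF.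
have F0 := Fmax _ K0.
(* The value +oo is excluded by f <= 0. If f is -oo at the maximum of F, it is -oo at [p0] too. *)
case fpE : (f p) => [m||]; last 2 first.
- by have := f0 _ Kp; rewrite fpE.
- move: F0; rewrite /F fpE /= leeNy_eq; case: (f p0) => [r0||]//= _.
  by rewrite leNye.
have le_sq : p0.1 ^+ 2 + p0.2 ^+ 2 >= 0 by rewrite addr_ge0 ?sqr_ge0.
have [bdp|] := pselect (p.1 ^+ 2 + p.2 ^+ 2 = R0 \/ (exists i, q i p = eta i)).
  have := bd _ Kp bdp; rewrite fpE lee_fin => mL.
  move: F0; rewrite /F fpE -EFinD; case: (f p0) (f0 _ K0) => [r0||]// _; last by move=> _; rewrite
      leNye.
  rewrite !lee_fin /k => F0; have [pR _] := Kp.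
  have := ler_wpM2l (ltW d0) pR; have := mulr_ge0 (ltW d0) le_sq; lra.
move=> /not_orP[nR nq].
have [pR pq] := Kp.
have pR' : p.1 ^+ 2 + p.2 ^+ 2 < R0 by rewrite lt_neqAle pR andbT; exact/eqP.
have pq' i : eta i < q i p.
  by rewrite lt_neqAle pq andbT eq_sym; apply/eqP => h; apply: nq; exists i.
have : \forall z \near p, pdisc z.
  have n1 : \forall z \near p, z.1 ^+ 2 + z.2 ^+ 2 < R0.
    by have /(@cvgr_lt _ _ _ _ _ (p.1 ^+ 2 + p.2 ^+ 2)) /(_ _ pR') := csq p.
  have n2 : \forall z \near p, forall i, eta i < q i z.
    apply: (@filter_forall _ I (fun i z => eta i < q i z) (nbhs p)) => i.
    by have /(@cvgr_gt _ _ _ _ _ (q i p)) /(_ _ (pq' i)) := @continuous_sqm (x i) (y i) (u i) (v i)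
        p.
  near=> z; have h2 : forall i, eta i < q i z by near: z; exact: n2.
  by split; [apply/ltW; near: z; exact: n1|move=> i; exact/ltW].
move=> /nbhs_ballP[e /= e0 ball_sub].
pose r := e / 2; have r0 : 0 < r by rewrite divr_gt0.
have disc s' t' : s' ^+ 2 + t' ^+ 2 <= r ^+ 2 -> pdisc (p.1 + s', p.2 + t').
  move=> h; apply: ball_sub; have re : r < e by rewrite /r ltr_pdivrMr//; lra.
  have b (a : R) : a ^+ 2 <= r ^+ 2 -> `|a| < e.
    by move=> ar; apply: le_lt_trans re; rewrite -(@ler_sqr _ `|a| r) ?nnegrE ?(ltW r0)//
        real_normK ?num_real.
  have h1 := sqr_ge0 s'; have h2 := sqr_ge0 t'.
  by split => /=; rewrite /ball/= opprD addNKr normrN; apply: b; lra.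
have := sub p.1 p.2 r r0 disc; rewrite -surjective_pairing fpE => mle.
have [ch Ih] := itv_integral_logsum d (ltW r0) disc.
set h := fun th => _ in ch Ih.
have cK : continuous (fun _ : R => m + k p) by move=> ?; exact: cvg_cst.
have chK : continuous (fun th => h th + (m + k p)) by move=> th; apply: cvgD; [exact: ch|exact: cK].
have oncirc th : (r * cos th) ^+ 2 + (r * sin th) ^+ 2 <= r ^+ 2.
  by rewrite !exprMn -mulrDr cos2Dsin2 mulr1.
have := le_trans mle (@le_circle_mean _ _ (fun th => (h th + (m + k p))%:E) _).
rewrite circle_meanE// (itv_integralD _ _ ch cK) Ih itv_integral_cst ?pi2_ge0// subr0.
have pp : 2 * pi != 0 :> R by rewrite gt_eqF// mulr_gt0// pi_gt0.
rewrite lee_fin mulrDr mulKf// (mulrC (m + _)) mulKf// -surjective_pairing.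
have dr : 0 < d * r ^+ 2 by rewrite mulr_gt0 ?exprn_gt0.
(* On the circle f <= h + m + k p by maximality, and the mean of the right side is m - d r^2 < m. *)
rewrite /k => abs; exfalso.
have : m <= logsum p - d * (p.1 ^+ 2 + p.2 ^+ 2 + r ^+ 2) + (m + (- logsum p + d * (p.1 ^+ 2 + p.2
    ^+ 2))).
  apply: abs => th; have := Fmax _ (disc _ _ (oncirc th)).
  rewrite /F fpE -EFinD; case: (f _) (f0 _ (disc _ _ (oncirc th))) => [r1||]// _; last by move=> _;
      rewrite leNye.
  by rewrite !lee_fin /k /h /=; lra.
by lra.
Unshelve. all: by end_near.
Qed.

End domain.
End maximum_principle.

(** * Two-constants estimates in one complex variable *)

Section two_constants.
Context {R : realType}.

Lemma sqm_le (x y u v s t r : R) : s ^+ 2 + t ^+ 2 <= r ->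
  sqm x y u v s t <= 2 * (x ^+ 2 + y ^+ 2) + 2 * r * (u ^+ 2 + v ^+ 2).
Proof.
move=> h; have := sqr_ge0 (x - (s * u - t * v)); have := sqr_ge0 (y - (s * v + t * u)).
have W0 : 0 <= u ^+ 2 + v ^+ 2 by rewrite addr_ge0 ?sqr_ge0.
have := ler_wpM2r W0 h.
have -> : (s ^+ 2 + t ^+ 2) * (u ^+ 2 + v ^+ 2) = (s * u - t * v) ^+ 2 + (s * v + t * u) ^+ 2 by
    ring.
rewrite /sqm; set a := s * u - t * v; set b := s * v + t * u.
have -> : x + s * u - t * v = x + a by rewrite /a; ring.
have -> : y + s * v + t * u = y + b by rewrite /b; ring.
have -> : 2 * r * (u ^+ 2 + v ^+ 2) = 2 * (r * (u ^+ 2 + v ^+ 2)) by ring.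
by nra.
Qed.

Definition submean_on (K : set (R * R)) (f : R * R -> \bar R) :=
  forall s t r : R, 0 < r ->
     (forall s' t', s' ^+ 2 + t' ^+ 2 <= r ^+ 2 -> K (s + s', t + t')) ->
     (f (s, t) <= circle_mean (fun th : R => f (s + r * cos th, t + r * sin th)%R))%E.

Definition annulus (I : Type) (x y u v : I -> R) (e eta R0 : R) : set (R * R) :=
  [set p | [/\ p.1 ^+ 2 + p.2 ^+ 2 <= R0, e <= p.1 ^+ 2 + p.2 ^+ 2 &
     forall i, eta <= sqm (x i) (y i) (u i) (v i) p.1 p.2]].

(** The central hole is that of one more affine function, the parameter itself, indexed by [None].
    Its logarithm thereby becomes available in majorants. *)
Lemma pdisc_annulus (I : finType) (x y u v : I -> R) (e eta R0 : R) :
  pdisc (oapp x 0) (oapp y 0) (oapp u 1) (oapp v 0) (oapp (fun=> eta) e) R0 =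
  annulus x y u v e eta R0.
Proof.
have sE (p : R * R) : sqm 0 0 1 0 p.1 p.2 = p.1 ^+ 2 + p.2 ^+ 2.
  by rewrite /sqm !mulr1 !mulr0 !add0r subr0.
apply/seteqP; split=> p.
  by move=> [h1 h2]; split=> //; [have := h2 None; rewrite /= sE|move=> i; exact: (h2 (Some i))].
by move=> [h1 h2 h3]; split=> // -[i|]; [exact: h3|rewrite /= sE].
Qed.

Lemma sum_option (I : finType) (F : option I -> R) :
  \sum_i F i = F None + \sum_i F (Some i).
Proof.
rewrite (bigD1 None)//=; congr (_ + _).
rewrite (reindex_omap Some id) /=; last by case.
by apply: eq_bigl => i; rewrite eqxx.
Qed.

Lemma annulus_log_majorant (I : finType) (x y u v : I -> R) (e eta R0 : R)
    (f : R * R -> \bar R) (c0 c1 : R) (c : I -> R) :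
  0 < e -> 0 < eta ->
  let K := annulus x y u v e eta R0 in
  let h := fun p => c0 + c1 * ln (p.1 ^+ 2 + p.2 ^+ 2) +
     \sum_i c i * ln (sqm (x i) (y i) (u i) (v i) p.1 p.2) in
  usc_on K f -> (forall p, K p -> (f p <= 0)%E) -> submean_on K f ->
  (forall p, K p -> [\/ p.1 ^+ 2 + p.2 ^+ 2 = R0, p.1 ^+ 2 + p.2 ^+ 2 = e |
      exists i, sqm (x i) (y i) (u i) (v i) p.1 p.2 = eta] -> (f p <= (h p)%:E)%E) ->
  forall p, K p -> (f p <= (h p)%:E)%E.
Proof.
move=> e0 eta0 K h; rewrite {}/K -pdisc_annulus => uscf f0 sub bd p Kp.
have sE (z : R * R) : sqm 0 0 1 0 z.1 z.2 = z.1 ^+ 2 + z.2 ^+ 2.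
  by rewrite /sqm !mulr1 !mulr0 !add0r subr0.
have hE z : h z = logsum (oapp x 0) (oapp y 0) (oapp u 1) (oapp v 0) (oapp c c1) c0 z.
  by rewrite /h /logsum sum_option /= sE addrA.
rewrite hE; apply: (log_maximum_principle _ uscf f0 sub _ Kp) => [[i|]//|z Kz bz].
rewrite -hE; apply: bd => //; case: bz => [->|[[i|] /= hi]].
- by constructor 1.
- by constructor 3; exists i.
- by constructor 2; rewrite -sE.
Qed.

(* The majorant is K (ln (|p|^2 / e) / L - 1) + K ep sum_i (ln C - ln q_i). A large R0 (that is,
   a large L) makes the first term close to -K at (1, 0), a small ep makes the second small there,
   and eta is then chosen so that the second term alone is at least K where some q_i = eta. *)
Lemma two_constants (I : finType) (x y u v : I -> R) (e d : R) :
  0 < e -> e <= 1 -> 0 < d -> d <= 1 ->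
  (forall i, 0 < sqm (x i) (y i) (u i) (v i) 1 0) ->
  exists R0 eta, [/\ 0 < eta, annulus x y u v e eta R0 (1, 0) &
    forall (f : R * R -> \bar R) (K : R), 0 <= K ->
    let A := annulus x y u v e eta R0 in
    usc_on A f -> (forall p, A p -> (f p <= 0)%E) -> submean_on A f ->
    (forall p, A p -> p.1 ^+ 2 + p.2 ^+ 2 = e -> (f p <= (- K)%:E)%E) ->
    (f (1, 0)%R <= (- ((1 - d) * K))%:E)%E].
Proof.
move=> e0 e1 d0 d1 q1.
pose a := - ln e; have a0 : 0 <= a by rewrite oppr_ge0 -ln1 ler_ln ?posrE.
(* L is ln (R0 / e). This choice gives a / L <= d / 2, which bounds the first term at (1, 0) by - (1
   - d / 2) K, and L > a, so that R0 > 1 and (1, 0) lies inside. *)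
pose L := 2 * a / d + a + 1.
have ad0 : 0 <= 2 * a / d by rewrite divr_ge0 ?(ltW d0)// mulr_ge0.
have L0 : 0 < L by rewrite /L; lra.
pose R0 := e * expR L; have R00 : 0 < R0 by rewrite mulr_gt0 ?expR_gt0.
have lnR0 : ln R0 = L - a by rewrite lnM ?posrE ?expR_gt0// expRK addrC opprK.
have R01 : 1 <= R0 by rewrite -ler_ln ?posrE// ln1 lnR0 /L; lra.
pose C := 1 + \sum_i (2 * (x i ^+ 2 + y i ^+ 2) + 2 * R0 * (u i ^+ 2 + v i ^+ 2)).
have T0 i : 0 <= 2 * (x i ^+ 2 + y i ^+ 2) + 2 * R0 * (u i ^+ 2 + v i ^+ 2).
  by rewrite addr_ge0// mulr_ge0 ?addr_ge0 ?sqr_ge0// mulr_ge0// ltW.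
have C0 : 0 < C by rewrite /C ltr_pwDl// sumr_ge0.
have qC i p : p.1 ^+ 2 + p.2 ^+ 2 <= R0 -> sqm (x i) (y i) (u i) (v i) p.1 p.2 <= C.
  move=> pR; apply: (le_trans (sqm_le _ _ _ _ pR)); rewrite /C (bigD1 i)//= addrCA lerDl.
  by rewrite addr_ge0// sumr_ge0.
have p1R : (1 : R, 0 : R).1 ^+ 2 + (1 : R, 0 : R).2 ^+ 2 = 1 by rewrite /= expr1n expr0n addr0.
pose g i p := ln C - ln (sqm (x i) (y i) (u i) (v i) p.1 p.2).
have g0 i p : p.1 ^+ 2 + p.2 ^+ 2 <= R0 -> 0 < sqm (x i) (y i) (u i) (v i) p.1 p.2 -> 0 <= g i p.
  by move=> pR q0; rewrite subr_ge0 ler_ln ?posrE// qC.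
have g1 i : 0 <= g i (1, 0) by apply: g0; rewrite ?p1R.
pose B := \sum_i g i (1, 0); have B0 : 0 <= B by apply: sumr_ge0.
(* B is the total penalty at (1, 0). There ep B <= d / 2, and B <= 1 / ep keeps (1, 0) out of the
   holes. *)
pose ep := d / (2 * (B + 1)); have B1 : 0 < 2 * (B + 1) by lra.
have ep0 : 0 < ep by rewrite divr_gt0.
pose eta := expR (ln C - ep^-1); have eta0 : 0 < eta by exact: expR_gt0.
have lneta : ln C - ln eta = ep^-1 by rewrite expRK opprB addrC subrK.
have epB : B <= ep^-1.
  rewrite /ep invf_div ler_pdivlMr//; nra.
exists R0, eta; split => //.
  split; rewrite ?p1R// => i; rewrite -ler_ln ?posrE// expRK.
  have : g i (1, 0) <= B by rewrite /B (bigD1 i)//= lerDl sumr_ge0.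
  by rewrite /g /=; lra.
move=> f K K0 A uscf f0 sub bd.
have Ap1 : A (1, 0).
  split; rewrite ?p1R// => i; rewrite -ler_ln ?posrE// expRK.
  have : g i (1, 0) <= B by rewrite /B (bigD1 i)//= lerDl sumr_ge0.
  by rewrite /g /=; lra.
pose c0 := - K + K / L * a + \sum_(i : I) K * ep * ln C.
have maj := @annulus_log_majorant I x y u v e eta R0 f c0 (K / L) (fun=> - (K * ep)) e0 eta0 uscf
    f0 sub.
pose h (p : R * R) := c0 + K / L * ln (p.1 ^+ 2 + p.2 ^+ 2) +
   \sum_i - (K * ep) * ln (sqm (x i) (y i) (u i) (v i) p.1 p.2).
have hE p : h p = - K + K / L * (a + ln (p.1 ^+ 2 + p.2 ^+ 2)) + K * ep * \sum_i g i p.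
  rewrite /h /c0 mulr_sumr.
  have -> : \sum_i K * ep * g i p = \sum_(i : I) K * ep * ln C + \sum_i - (K * ep) * ln (sqm (x i)
      (y i) (u i) (v i) p.1 p.2).
    by rewrite -big_split/=; apply: eq_bigr => i _; rewrite /g; ring.
  by ring.
have KL0 : 0 <= K / L by rewrite divr_ge0// ltW.
have Kep : 0 <= K * ep by rewrite mulr_ge0// ltW.
have bdh p : A p -> [\/ p.1 ^+ 2 + p.2 ^+ 2 = R0, p.1 ^+ 2 + p.2 ^+ 2 = e |
    exists i, sqm (x i) (y i) (u i) (v i) p.1 p.2 = eta] -> (f p <= (h p)%:E)%E.
  move=> [pR pe peta] bp.
  have q0 i : 0 < sqm (x i) (y i) (u i) (v i) p.1 p.2 by exact: lt_le_trans (peta i).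
  have gp i : 0 <= g i p by exact: g0.
  have S0 : 0 <= \sum_i g i p by apply: sumr_ge0.
  have l0 : 0 <= a + ln (p.1 ^+ 2 + p.2 ^+ 2).
    by rewrite addrC subr_ge0 ler_ln ?posrE// (lt_le_trans e0).
  have t1 := mulr_ge0 KL0 l0; have t2 := mulr_ge0 Kep S0.
  case: bp => [bp|bp|[i bp]].
  - apply: (le_trans (f0 _ _)); first by split.
    rewrite lee_fin hE bp lnR0.
    have -> : K / L * (a + (L - a)) = K by field; rewrite gt_eqF.
    by lra.
  - apply: (le_trans (bd _ _ bp)); first by split.
    by rewrite lee_fin hE; lra.
  - apply: (le_trans (f0 _ _)); first by split.
    rewrite lee_fin hE.
    have : K * ep * g i p <= K * ep * \sum_i g i p.
      by apply: ler_wpM2l => //; rewrite (bigD1 i)//= lerDl sumr_ge0.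
    have -> : K * ep * g i p = K by rewrite /g bp lneta mulfK// gt_eqF.
    by lra.
apply: (le_trans (maj bdh _ Ap1)); rewrite -/(h (1, 0)) lee_fin hE p1R ln1 addr0.
have -> : \sum_i g i (1, 0) = B by [].
have aL : K / L * a <= K * (d / 2).
  rewrite -mulrA; apply: ler_wpM2l => //; rewrite mulrC ler_pdivrMr// /L.
  have -> : d / 2 * (2 * a / d + a + 1) = a + d / 2 * (a + 1) by field; rewrite gt_eqF.
  have := mulr_ge0 (ltW d0) a0; lra.
have epd : K * ep * B <= K * (d / 2).
  rewrite -mulrA; apply: ler_wpM2l => //; rewrite /ep mulrAC ler_pdivrMr//; nra.
by lra.
Qed.

(** For b < 1 compare f with b (ln N - ln R0) on an annulus: on the outer circle this is 0, and on a
    small inner circle the steeper slope b' > b wins over the constant M. Then b tends to 1. The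
    centre is excluded from K, so the slope hypothesis replaces information at 0. *)
Lemma log_slope (f : R * R -> \bar R) (R0 : R) :
  let K := [set p : R * R | 0 < p.1 ^+ 2 + p.2 ^+ 2 <= R0] in
  usc_on K f -> (forall p, K p -> (f p <= 0)%E) -> submean_on K f ->
  (forall b : R, 0 < b -> b < 1 -> exists r0 M : R, 0 < r0 /\
     forall p, K p -> p.1 ^+ 2 + p.2 ^+ 2 <= r0 ->
       (f p <= (b * ln (p.1 ^+ 2 + p.2 ^+ 2) + M)%:E)%E) ->
  forall p, K p -> (f p <= (ln (p.1 ^+ 2 + p.2 ^+ 2) - ln R0)%:E)%E.
Proof.
move=> K uscf f0 sub slope p Kp; have /andP[p0 pR] := Kp.
have R00 : 0 < R0 by exact: lt_le_trans pR.
set N := p.1 ^+ 2 + p.2 ^+ 2 in p0 pR *.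
have H b : 0 < b -> b < 1 -> (f p <= (b * (ln N - ln R0))%:E)%E.
  move=> b0 b1; pose b' := (b + 1) / 2.
  have [b'0 b'1 bb'] : [/\ 0 < b', b' < 1 & 0 < b' - b] by rewrite /b'; split; lra.
  have [r0 [M [r00 hM]]] := slope b' b'0 b'1.
  (* The last entry is the solution of b' ln e + M = b (ln e - ln R0); the first two keep [p] in the
     annulus and the inner circle within reach of [slope]. *)
  pose e := Num.min N (Num.min r0 (expR (- (M + b * ln R0) / (b' - b)))).
  have e0 : 0 < e by rewrite /e !lt_min p0 r00 expR_gt0.
  have eN : e <= N by rewrite /e ge_min lexx.
  have er : e <= r0 by rewrite /e !ge_min lexx orbT.
  have lne : ln e <= - (M + b * ln R0) / (b' - b).
    by rewrite -[leRHS]expRK ler_ln ?posrE ?expR_gt0// /e !ge_min lexx !orbT.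
  pose vv := fun _ : void => 0 : R.
  have sK' q : annulus vv vv vv vv e 1 R0 q -> K q.
    by move=> [h1 h2 _]; rewrite /K /=; apply/andP; split => //; exact: lt_le_trans h2.
  have := @annulus_log_majorant void vv vv vv vv e 1 R0 f (- (b * ln R0)) b vv e0 ltr01.
  move=> /(_ _ _ _ _ p) maj; rewrite (_ : b * _ = - (b * ln R0) + b * ln N + 0); last by ring.
  have -> : 0 = \sum_(i : void) vv i * ln (sqm (vv i) (vv i) (vv i) (vv i) p.1 p.2).
    by rewrite big1//; case.
  apply: maj.
  - by move=> q /sK'; exact: uscf.
  - by move=> q /sK'; exact: f0.
  - by move=> s t r r1 h; apply: sub => // s' t' /h /sK'.
  - move=> q Aq; have Kq := sK' _ Aq; rewrite big1 ?addr0; last by case.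
    case=> [->|qe|[[]]].
    + by apply: (le_trans (f0 _ Kq)); rewrite lee_fin addrC subrr.
    + apply: (le_trans (hM _ Kq _)); first by rewrite qe.
      rewrite lee_fin qe; move: lne; rewrite ler_pdivlMr//; lra.
  - by split=> // -[].
apply/lee_addgt0Pr => ee ee0; have ND : 0 <= ln R0 - ln N by rewrite subr_ge0 ler_ln ?posrE.
(* Chosen so that (1 - b) (ln R0 - ln N) <= ee, the 1/2 keeping b positive. *)
pose b := 1 - Num.min (1 / 2) (ee / (ln R0 - ln N + 1)).
have D1 : 0 < ln R0 - ln N + 1 by lra.
have m0 : 0 < Num.min (1 / 2) (ee / (ln R0 - ln N + 1)) by rewrite lt_min !divr_gt0.
have m1 : Num.min (1 / 2) (ee / (ln R0 - ln N + 1)) <= 1 / 2 by rewrite ge_min lexx.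
have m2 : Num.min (1 / 2) (ee / (ln R0 - ln N + 1)) <= ee / (ln R0 - ln N + 1) by rewrite ge_min
    lexx orbT.
apply: (le_trans (H b _ _)); [by rewrite /b; lra|by rewrite /b; lra|].
rewrite -EFinD lee_fin /b; move: m2; rewrite ler_pdivlMr//; set m := Num.min _ _ => m2.
by rewrite -/m in m0; nra.
Qed.

End two_constants.

(** * Complex lines and the restriction of plurisubharmonic functions to them *)

Section complex_lines.
Context {R : realType} {n : nat}.
Implicit Types (z w : Cn R n) (s t : R) (j k : 'I_n).

Lemma re_cline z w s t j : re (cline z w s t) j = re z j + s * re w j - t * im w j.
Proof. by rewrite /re /im /cline /= !mxE. Qed.

Lemma im_cline z w s t j : im (cline z w s t) j = im z j + s * im w j + t * re w j.
Proof. by rewrite /re /im /cline /= !mxE. Qed.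

Definition sqabs z j := re z j ^+ 2 + im z j ^+ 2.

Lemma sqabs_ge0 z j : 0 <= sqabs z j. Proof. by rewrite addr_ge0 ?sqr_ge0. Qed.

Lemma sqabs_cline z w s t j :
  sqabs (cline z w s t) j = sqm (re z j) (im z j) (re w j) (im w j) s t.
Proof. by rewrite /sqabs re_cline im_cline. Qed.

Lemma cabsE z j : cabs z j = Num.sqrt (sqabs z j). Proof. by []. Qed.

Lemma cabs_ge0 z j : 0 <= cabs z j. Proof. exact: sqrtr_ge0. Qed.

Lemma sqr_cabs z j : cabs z j ^+ 2 = sqabs z j.
Proof. by rewrite sqr_sqrtr// sqabs_ge0. Qed.

Lemma cabs_neq0 z j : (cabs z j != 0) = (0 < sqabs z j).
Proof. by rewrite sqrtr_eq0 -ltNge. Qed.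

Lemma cabs_eq0 z j : cabs z j = 0 <-> re z j = 0 /\ im z j = 0.
Proof.
split=> [/eqP|[r0 i0]]; last by rewrite cabsE /sqabs r0 i0 expr0n addr0 sqrtr0.
rewrite sqrtr_eq0 /= => h; have := sqr_ge0 (re z j); have := sqr_ge0 (im z j) => h1 h2.
by split; apply/eqP; rewrite -sqrf_eq0; apply/eqP; lra.
Qed.

Lemma cline_add z w s t s' t' : cline (cline z w s t) w s' t' = cline z w (s + s') (t + t').
Proof. by rewrite /cline /=; congr pair; apply/rowP => j; rewrite !mxE; ring. Qed.

Lemma cline0 z w : cline z w 0 0 = z.
Proof. by case: z => a b; rewrite /cline /= !scale0r subr0 !addr0. Qed.

Lemma continuous_re j : continuous (fun z => re z j).
Proof.
move=> z; apply: (@continuous_comp _ _ _ fst (fun A : 'rV[R]_n => A ord0 j)); first exact: cvg_fst.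
exact: coord_continuous.
Qed.

Lemma continuous_im j : continuous (fun z => im z j).
Proof.
move=> z; apply: (@continuous_comp _ _ _ snd (fun A : 'rV[R]_n => A ord0 j)); first exact: cvg_snd.
exact: coord_continuous.
Qed.

Lemma continuous_sqabs j : continuous (fun z => sqabs z j).
Proof.
rewrite (_ : (fun z => _) = (fun z => re z j * re z j + im z j * im z j)).
  by move=> z; apply: cvgD; apply: cvgM; [exact: continuous_re|exact: continuous_re|exact:
      continuous_im|exact: continuous_im].
by apply/funext => z; rewrite /sqabs !expr2.
Qed.

Lemma continuous_at_pair (T U V : topologicalType) (f : T -> U) (g : T -> V) (p : T) :
  {for p, continuous f} -> {for p, continuous g} ->
  {for p, continuous (fun p => (f p, g p))}.
Proof. exact: (@cvg_pair _ _ _ (nbhs p) (nbhs (f p)) (nbhs (g p)) _ _ _ f g). Qed.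

Lemma continuous_cline w : continuous (fun p : Cn R n * (R * R) => cline p.1 w p.2.1 p.2.2).
Proof.
have c1 : continuous (fun p : Cn R n * (R * R) => p.1.1).
  by move=> p; apply: (@continuous_comp _ _ _ fst fst); exact: cvg_fst.
have c2 : continuous (fun p : Cn R n * (R * R) => p.1.2).
  by move=> p; apply: (@continuous_comp _ _ _ fst snd); [exact: cvg_fst|exact: cvg_snd].
have c3 : continuous (fun p : Cn R n * (R * R) => p.2.1).
  by move=> p; apply: (@continuous_comp _ _ _ snd fst); [exact: cvg_snd|exact: cvg_fst].
have c4 : continuous (fun p : Cn R n * (R * R) => p.2.2).
  by move=> p; apply: (@continuous_comp _ _ _ snd snd); exact: cvg_snd.
move=> p.
apply: (@continuous_at_pair _ _ _ (fun p : Cn R n * (R * R) => p.1.1 + p.2.1 *: w.1 - p.2.2 *: w.2)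
  (fun p : Cn R n * (R * R) => p.1.2 + p.2.1 *: w.2 + p.2.2 *: w.1)).
- apply: cvgB; first apply: cvgD; first exact: c1.
  + by apply: cvgZr_tmp; exact: c3.
  + by apply: cvgZr_tmp; exact: c4.
- apply: cvgD; first apply: cvgD; first exact: c2.
  + by apply: cvgZr_tmp; exact: c3.
  + by apply: cvgZr_tmp; exact: c4.
Qed.

Lemma continuous_line z w : continuous (fun p : R * R => cline z w p.1 p.2).
Proof.
move=> p; apply: (@continuous_comp _ _ _ (fun p : R * R => (z, p)) (fun p => cline p.1 w p.2.1
    p.2.2)).
  by apply: continuous_at_pair; [exact: cvg_cst|exact: cvg_id].
exact: continuous_cline.
Qed.

Lemma psh_slice (G : set (Cn R n)) (v : Cn R n -> \bar R) z w (K : set (R * R)) :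
  psh G v -> (forall p, K p -> G (cline z w p.1 p.2)) ->
  usc_on K (fun p => v (cline z w p.1 p.2)) /\
  submean_on K (fun p => v (cline z w p.1 p.2)).
Proof.
move=> [_ [uscv subv]] KG; split.
  move=> p Kp c vc; have := uscv _ (KG _ Kp) c vc.
  exact: (@continuous_line z w p).
move=> s t r r0 disc /=.
have Gst : G (cline z w s t).
  by have := KG _ (disc 0 0 _); rewrite !addr0; apply; rewrite expr0n/= addr0 sqr_ge0.
have := subv (cline z w s t) w r Gst r0; rewrite /circle_mean.
under eq_integral do rewrite cline_add.
apply=> s' t' h; rewrite cline_add; exact: KG (disc _ _ h).
Qed.

(* Coordinates with alpha_j >= 0 are replaced by the constant 1: only the others have to stay
   away from 0 along the line. *)
Definition line_annulus (alpha : 'I_n -> R) z w (e eta R0 : R) : set (R * R) :=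
  annulus (fun j => if alpha j < 0 then re z j else 1)
          (fun j => if alpha j < 0 then im z j else 0)
          (fun j => if alpha j < 0 then re w j else 0)
          (fun j => if alpha j < 0 then im w j else 0) e eta R0.

Lemma line_annulusE alpha z w e eta R0 p : line_annulus alpha z w e eta R0 p -> 0 < eta ->
  forall j, alpha j < 0 -> eta <= sqabs (cline z w p.1 p.2) j.
Proof. by move=> [_ _ h] _ j aj; rewrite sqabs_cline; have := h j; rewrite aj. Qed.

(** R0 and eta depend only on the coordinates with alpha j < 0, and are fixed before v, K and z. One
    choice thus serves all parallel lines whose base points agree with z0 in those coordinates, with
    K as large as desired. *)
Lemma move_along_line alpha z0 w (e d : R) :
  0 < e -> e <= 1 -> 0 < d -> d <= 1 ->
  (forall j, alpha j < 0 -> cabs (cline z0 w 1 0) j != 0) ->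
  exists R0 eta, 0 < eta /\
    forall (G : set (Cn R n)) (v : Cn R n -> \bar R) (K : R) z, 0 <= K -> psh G v ->
      (forall y, G y -> (v y <= 0)%E) ->
      (forall j, alpha j < 0 -> re z j = re z0 j /\ im z j = im z0 j) ->
      (forall p, line_annulus alpha z0 w e eta R0 p -> G (cline z w p.1 p.2)) ->
      (forall p, p.1 ^+ 2 + p.2 ^+ 2 = e -> (v (cline z w p.1 p.2) <= (- K)%:E)%E) ->
      (v (cline z w 1 0) <= (- ((1 - d) * K))%:E)%E.
Proof.
move=> e0 e1 d0 d1 nz.
have [|R0 [eta [eta0 A1 H]]] := @two_constants R 'I_n
    (fun j => if alpha j < 0 then re z0 j else 1)
    (fun j => if alpha j < 0 then im z0 j else 0)
    (fun j => if alpha j < 0 then re w j else 0)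
    (fun j => if alpha j < 0 then im w j else 0) e d e0 e1 d0 d1.
  move=> j; have [aj|aj] := boolP (alpha j < 0).
    by have := nz _ aj; rewrite cabs_neq0 sqabs_cline.
  by rewrite /sqm !mulr0 !addr0 !subr0 expr1n expr0n addr0.
exists R0, eta; split=> // G v K z K0 pv v0 zz0 AG vK.
have [uscf subf] := psh_slice pv AG.
apply: (H (fun p => v (cline z w p.1 p.2)) K K0 uscf _ subf).
  by move=> p /AG /v0.
by move=> p _ /vK.
Qed.

End complex_lines.

(** * Differentiation along real lines *)

Section calculus_on_lines.
Context {R : realType} {V : normedModType R}.
Implicit Types (f : V -> R) (y v : V).

Lemma is_derive_line f y v (s : R) : derivable f (y + s *: v) v ->
  is_derive s 1 (fun t : R => f (y + t *: v)) ('D_v f (y + s *: v)).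
Proof.
have E : (fun h : R => h^-1 *: (((fun t : R => f (y + t *: v)) \o shift s) (h *: (1 : R)) - f (y +
    s *: v))) =
   (fun h : R => h^-1 *: ((f \o shift (y + s *: v)) (h *: v) - f (y + s *: v))).
  apply/funext => h /=; congr (_ *: (f _ - _)).
  by rewrite [h *: 1]mulr1 scalerDl addrCA addrA.
by move=> df; apply: DeriveDef; rewrite /derivable /derive E.
Qed.

Lemma mvt_line f y v (s : R) :
  (forall r : R, `|r| <= `|s| -> derivable f (y + r *: v) v) ->
  exists2 r : R, `|r| <= `|s| & f (y + s *: v) - f y = s * 'D_v f (y + r *: v).
Proof.
move=> df; pose g (t : R) := f (y + t *: v); pose dg t := 'D_v f (y + t *: v).
have dgP (t : R) : `|t| <= `|s| -> is_derive t 1 g (dg t) by move=> /df; exact: is_derive_line.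
have key (a b : R) : a <= b -> (forall t, t \in `[a, b] -> `|t| <= `|s|) ->
    exists2 r, `|r| <= `|s| & g b - g a = dg r * (b - a).
  move=> ab tab; have [||r rab ->] := @MVT_segment R g dg a b ab.
  - by move=> t /subset_itv_oo_cc /tab; exact: dgP.
  - apply: derivable_within_continuous => t /tab /dgP td; exact: ex_derive.
  - by exists r => //; exact: tab.
have gs : g 0 = f y by rewrite /g scale0r addr0.
have [s0|s0] := leP 0 s.
  have [|r rs e] := key 0 s s0.
    by move=> t; rewrite in_itv /= => /andP[t0 ts]; rewrite !ger0_norm.
  by exists r => //; rewrite -gs -/(g s) e subr0 mulrC.
have [|r rs e] := key s 0 (ltW s0).
  by move=> t; rewrite in_itv /= => /andP[ts t0]; rewrite !ler0_norm ?lerN2// ltW.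
exists r => //; rewrite -gs -/(g s) -(opprB (g 0)) e sub0r mulrN opprK mulrC.
by [].
Qed.

Lemma derive_at_line_min f y v (e : R) : 0 < e ->
  (forall r : R, `|r| < e -> derivable f (y + r *: v) v) ->
  (forall r : R, `|r| < e -> f y <= f (y + r *: v)) -> 'D_v f y = 0.
Proof.
move=> e0 df fmin; pose g (t : R) := f (y + t *: v).
have itvP t : t \in `]- e, e[ -> `|t| < e by rewrite in_itv /= ltr_norml.
have d0 : derivable f (y + 0 *: v) v by apply: df; rewrite normr0.
have e00 : (0 : R) \in `]- e, e[ by rewrite in_itv /= oppr_lt0 e0.
have ee : - e <= e by lra.
have [_ g0] := @derive1_at_min R g (- e) e 0 ee
  (fun t ht => @ex_derive _ _ _ _ _ _ _ (is_derive_line (df t (itvP t ht)))) e00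
  (fun t ht => ltac:(rewrite /g scale0r addr0; exact: fmin (itvP t ht))).
have [_ g1] := is_derive_line d0; move: g1; rewrite -/g g0 scale0r addr0.
by [].
Qed.

End calculus_on_lines.

(** * Quadratic vanishing at a hyperplane *)

Section quadratic_bound.
Context {R : realType} {n : nat}.
Implicit Types (y z : Cn R n) (j k : 'I_n).

Definition e1 k : Cn R n := (delta_mx ord0 k, 0).
Definition e2 k : Cn R n := (0, delta_mx ord0 k).

Lemma cline_e1 y k (s t : R) : cline y (e1 k) s t = y + s *: e1 k + t *: e2 k.
Proof.
case: y => a b; rewrite /cline /e1 /e2; apply/eqP; rewrite xpair_eqE /=; apply/andP; split;
    apply/eqP.
  by apply/rowP => i; rewrite !mxE; ring.
by apply/rowP => i; rewrite !mxE; ring.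
Qed.

Lemma re_e1 y k s t j : re (cline y (e1 k) s t) j = if j == k then re y j + s else re y j.
Proof. by rewrite re_cline /re /im /e1 /= !mxE eqxx /= mulr0 subr0; case: eqP; rewrite ?mulr1
    ?mulr0 ?addr0. Qed.

Lemma im_e1 y k s t j : im (cline y (e1 k) s t) j = if j == k then im y j + t else im y j.
Proof. by rewrite im_cline /re /im /e1 /= !mxE eqxx /= mulr0 addr0; case: eqP; rewrite ?mulr1
    ?mulr0 ?addr0. Qed.

Lemma ball_CnP (a y : Cn R n) (e : R) : 0 < e ->
  ball a e y <-> forall j, `|re a j - re y j| < e /\ `|im a j - im y j| < e.
Proof.
move=> e0; split.
  by move=> [[_ h1] [_ h2]] j; split; [exact: h1|exact: h2].
by move=> h; split; split=> // i j; rewrite ord1; have [] := h j.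
Qed.

(** Here a and b are slopes met on the path (0, 0), (s, 0), (s, t), and c is the slope in the second
    direction at the corner. The increment is s a + t (b - c) + t c, and the mixed term is absorbed
    by 2 |s t| <= s^2 + t^2. *)
Lemma quad_arith (s t M a b c U1 U2 s1 t1 : R) : 0 <= M ->
  U1 - 0 = s * a -> U2 - U1 = t * b -> `|a| <= `|s1| * M -> `|c| <= `|s| * M ->
  `|b - c| <= `|t1| * M -> `|s1| <= `|s| -> `|t1| <= `|t| ->
  U2 <= 2 * M * (s ^+ 2 + t ^+ 2).
Proof.
move=> M0 e1 e2 ha hc hbc hs ht.
have -> : U2 = s * a + t * (b - c) + t * c by rewrite mulrBr; lra.
apply: (le_trans (ler_norm _)); apply: (le_trans (ler_normD _ _)).
apply: (le_trans (lerD (ler_normD _ _) (lexx _))); rewrite !normrM.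
have A1 : `|s| * `|a| <= `|s| * (`|s| * M).
  by apply: ler_wpM2l => //; apply: (le_trans ha); apply: ler_wpM2r.
have A2 : `|t| * `|b - c| <= `|t| * (`|t| * M).
  by apply: ler_wpM2l => //; apply: (le_trans hbc); apply: ler_wpM2r.
have A3 : `|t| * `|c| <= `|t| * (`|s| * M) by apply: ler_wpM2l.
rewrite -(real_normK (num_real s)) -(real_normK (num_real t)).
have := mulr_ge0 M0 (sqr_ge0 (`|s| - `|t|)).
by move: A1 A2 A3; set x1 := _ * `|a|; set x2 := _ * `|_ - _|; set x3 := _ * `|c|; nra.
Qed.

Lemma near_and4 (T : topologicalType) (a : T) (P1 P2 P3 P4 : T -> Prop) :
  (\forall y \near a, P1 y) -> (\forall y \near a, P2 y) ->
  (\forall y \near a, P3 y) -> (\forall y \near a, P4 y) ->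
  \forall y \near a, P1 y /\ P2 y /\ P3 y /\ P4 y.
Proof. by move=> h1 h2 h3 h4; near do do !split. Unshelve. all: by end_near. Qed.

(* The mixed derivative is needed because C2_near does not give linearity of v |-> 'D_v u, so
   the direction from (.., 0, ..) to y cannot be used directly. *)
Lemma quadratic_bound (G : set (Cn R n)) (u : Cn R n -> R) (a : Cn R n) k :
  C2_near G u a -> cabs a k = 0 -> (forall y, G y -> 0 <= u y) ->
  (forall y, G y -> cabs y k = 0 -> u y = 0) ->
  exists2 C : R, 0 < C & \forall y \near a, u y <= C * sqabs y k.
Proof.
move=> [U [oU Ua UG C2]] /cabs_eq0[rak iak] u0 uk.
pose D11 := 'D_(e1 k) ('D_(e1 k) u); pose D12 := 'D_(e1 k) ('D_(e2 k) u).
pose D22 := 'D_(e2 k) ('D_(e2 k) u).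
have bdd (D : Cn R n -> R) : (forall x, U x -> {for x, continuous D}) ->
    exists2 B : R, 0 < B & \forall y \near a, `|D y| <= B.
  move=> cD; exists (`|D a| + 1); first by rewrite ltr_wpDl.
  have c1 : {for a, continuous (fun y => `|D y|)}.
    by apply: (continuous_comp (cD a Ua)); exact: norm_continuous.
  have lt1 : `|D a| < `|D a| + 1 by rewrite ltrDl.
  have /(@cvgr_le _ _ _ _ _ `|D a|) := c1; exact.
have [B1 B10 b11] := bdd D11 (C2 (e1 k) (e1 k)).2.
have [B2 B20 b12] := bdd D12 (C2 (e2 k) (e1 k)).2.
have [B3 B30 b22] := bdd D22 (C2 (e2 k) (e2 k)).2.
have UN : \forall y \near a, U y by exact: open_nbhs_nbhs.
have : \forall y \near a, U y /\ `|D11 y| <= B1 /\ `|D12 y| <= B2 /\ `|D22 y| <= B3.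
  exact: (near_and4 UN b11 b12 b22).
move=> /nbhs_ballP[e /= e0 sub].
have [M [M0 M1 M2 M3]] : exists M, [/\ 0 < M, B1 <= M, B2 <= M & B3 <= M].
  by exists (B1 + B2 + B3); clear -B10 B20 B30; split; lra.
exists (2 * M); first by rewrite mulr_gt0.
apply/nbhs_ballP; exists e => //= y /(ball_CnP _ _ e0) ya.
pose s := re y k; pose t := im y k.
have [sy ty] : `|s| < e /\ `|t| < e.
  by have := ya k; rewrite rak iak !sub0r !normrN.
(* The foot of y on {z_k = 0}. Balls are products of coordinate intervals, so the whole path from y0
   to y stays in the ball around a. *)
pose y0 := cline y (e1 k) (- s) (- t).
have inball (s' t' : R) : `|s'| <= `|s| -> `|t'| <= `|t| -> ball a e (y0 + s' *: e1 k + t' *: e2 k).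
  move=> hs ht; rewrite -cline_e1; apply/(ball_CnP _ _ e0) => j.
  rewrite re_e1 im_e1 /y0 re_e1 im_e1; case: eqP => [->|_]; last exact: ya.
  by rewrite rak iak !subrr !add0r !normrN; split; [exact: le_lt_trans sy|exact: le_lt_trans ty].
have yE : y = y0 + s *: e1 k + t *: e2 k.
  by rewrite -cline_e1 /y0 cline_add !addNr cline0.
have y0E s' : y0 + s' *: e1 k = y0 + s' *: e1 k + 0 *: e2 k by rewrite scale0r addr0.
have [r0 r0'] : `|0 : R| <= `|s| /\ `|0 : R| <= `|t| by rewrite normr0 !normr_ge0.
have Uin (s' t' : R) (hs : `|s'| <= `|s|) (ht : `|t'| <= `|t|) : U (y0 + s' *: e1 k + t' *: e2 k)
    by have [] := sub _ (inball s' t' hs ht).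
have Uin1 (r : R) (hr : `|r| <= `|s|) : U (y0 + r *: e1 k) by rewrite y0E; exact: Uin.
have Uy0 : U y0 by have := Uin 0 0 r0 r0'; rewrite !scale0r !addr0.
have uy0 : u y0 = 0.
  apply: uk; [exact: UG|apply/cabs_eq0].
  by rewrite /y0 re_e1 im_e1 eqxx /s /t !subrr.
(* Since u >= 0 and u y0 = 0, the point y0 is a minimum on every line through it. *)
have minD v : 'D_v u y0 = 0.
  have cv : {for (0 : R), continuous (fun r : R => y0 + r *: v)}.
    by apply: cvgD; [exact: cvg_cst|apply: cvgZr_tmp; exact: cvg_id].
  have : \forall r \near (0 : R), U (y0 + r *: v).
    by apply: cv; rewrite /= scale0r addr0; exact: open_nbhs_nbhs.
  move=> /nbhs_ballP[d /= d0 dU].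
  have dU' (r : R) : `|r| < d -> U (y0 + r *: v) by move=> h; apply: dU; rewrite /ball /= sub0r
      normrN.
  apply: (@derive_at_line_min _ _ u y0 v d d0).
    by move=> r /dU' Ur; exact: ((C2 v v).1 _ Ur).1.
  by move=> r /dU' Ur; rewrite uy0; apply: u0; exact: UG.
have bound (v w : Cn R n) (x : Cn R n) (r B : R) : (forall r' : R, `|r'| <= `|r| -> U (x + r' *: w)
    /\ `|'D_w ('D_v u) (x + r' *: w)| <= B) ->
    `|'D_v u (x + r *: w) - 'D_v u x| <= `|r| * B.
  move=> h; have [r' hr ->] := @mvt_line _ _ ('D_v u) x w r (fun r' hr => ((C2 v w).1 _ (h r'
      hr).1).2).
  by rewrite normrM ler_wpM2l//; exact: (h _ hr).2.
have [s1 hs1 es] := @mvt_line _ _ u y0 (e1 k) s (fun r hr => ((C2 (e1 k) (e1 k)).1 _ (Uin1 r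
    hr)).1).
have [t1 ht1 et] := @mvt_line _ _ u (y0 + s *: e1 k) (e2 k) t (fun r hr => ((C2 (e2 k) (e2 k)).1 _
    (Uin s r (lexx _) hr)).1).
have bs1 : `|'D_(e1 k) u (y0 + s1 *: e1 k)| <= `|s1| * M.
  have := @bound (e1 k) (e1 k) y0 s1 M; rewrite minD subr0; apply => r' hr.
  have hr' := le_trans hr hs1; rewrite y0E.
  by have [h1 [h2 _]] := sub _ (inball r' 0 hr' r0'); split=> //; apply: (le_trans h2).
have bs2 : `|'D_(e2 k) u (y0 + s *: e1 k)| <= `|s| * M.
  have := @bound (e2 k) (e1 k) y0 s M; rewrite minD subr0; apply => r' hr'.
  rewrite y0E.
  by have [h1 [_ [h2 _]]] := sub _ (inball r' 0 hr' r0'); split=> //; apply: (le_trans h2).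
have bt1 : `|'D_(e2 k) u (y0 + s *: e1 k + t1 *: e2 k) - 'D_(e2 k) u (y0 + s *: e1 k)| <= `|t1| * M.
  apply: bound => r' hr; have hr' := le_trans hr ht1.
  by have [h1 [_ [_ h2]]] := sub _ (inball s r' (lexx _) hr'); split=> //; apply: (le_trans h2).
rewrite {1}yE /sqabs -/s -/t; rewrite uy0 in es.
exact: (quad_arith (ltW M0) es et bs1 bs2 bt1 hs1 ht1).
Qed.

End quadratic_bound.

(** * The upper bound for members of the class *)

Section upper_bound.
Context {R : realType} {n : nat}.
Variables (alpha : 'I_n -> R) (a : Cn R n) (u : Cn R n -> R) (k : 'I_n).
Implicit Types (y z w : Cn R n) (j : 'I_n).

Definition zpow_off z := \prod_(j < n | j != k) (cabs z j `^ alpha j).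

Lemma zpowE z : zpow alpha z = cabs z k `^ alpha k * zpow_off z.
Proof. by rewrite /zpow (bigD1 k). Qed.

Lemma zpow_ge0 z : 0 <= zpow alpha z.
Proof. by apply: prodr_ge0 => j _; exact: powR_ge0. Qed.

Lemma zpow_off_ge0 z : 0 <= zpow_off z.
Proof. by apply: prodr_ge0 => j _; exact: powR_ge0. Qed.

(** The bound e <= 1 is arranged because the two-constants estimate is evaluated at (1, 0), which
    must not fall in the central hole. *)
Lemma near0_disc (P : R * R -> Prop) : (\forall p \near ((0, 0) : R * R), P p) ->
  exists e : R, [/\ 0 < e, e <= 1 & forall p, p.1 ^+ 2 + p.2 ^+ 2 <= e -> P p].
Proof.
move=> /nbhs_ballP[r /= r0 rP]; exists (Num.min 1 ((r / 2) ^+ 2)).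
split; [by rewrite lt_min ltr01 exprn_gt0// divr_gt0|by rewrite ge_min lexx|].
move=> p; rewrite le_min => /andP[_ h]; apply: rP.
have r2 : r / 2 < r by rewrite ltr_pdivrMr//; lra.
have b (c : R) : c ^+ 2 <= (r / 2) ^+ 2 -> `|0 - c| < r.
  rewrite sub0r normrN => cr; apply: le_lt_trans r2.
  by rewrite -(@ler_sqr _ `|c|) ?nnegrE ?divr_ge0 ?(ltW r0)// real_normK ?num_real.
by have := sqr_ge0 p.1; have := sqr_ge0 p.2; split; apply: b; lra.
Qed.

Hypothesis ak0 : 0 < alpha k.

Lemma zpow_eq0 z : cabs z k = 0 -> zpow alpha z = 0.
Proof. by move=> zk; rewrite zpowE zk powR0 ?mul0r// gt_eqF. Qed.

Definition vector_to z w : Cn R n := (w.1 - z.1, w.2 - z.2).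

Lemma cline_vector_to z w : cline z (vector_to z w) 1 0 = w.
Proof.
case: w => w1 w2; rewrite /cline /vector_to /=.
by rewrite !scale1r !scale0r subr0 addr0 (addrC z.1) (addrC z.2) !subrK.
Qed.

Lemma re_vector_to z w j : re (vector_to z w) j = re w j - re z j.
Proof. by rewrite /re /vector_to !mxE. Qed.

Lemma im_vector_to z w j : im (vector_to z w) j = im w j - im z j.
Proof. by rewrite /im /vector_to !mxE. Qed.

Hypothesis aD : Dalpha alpha a.
Hypothesis ak : cabs a k = 0.
Hypothesis uS : S_class (Dalpha alpha) a u.

Let D := Dalpha alpha.
Let v z := lne (u z)%:E.

Lemma v_le0 z : D z -> (v z <= 0)%E.
Proof.
have [u01 _ _ _] := uS.
by move=> /u01 /andP[_ u1]; rewrite /v lne_le0 lee_fin ltW.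
Qed.

Lemma psh_v : psh D v. Proof. by case: uS. Qed.

(** On the line from a to z the k-th coordinate is identically 0, so the line stays in D except at
    the holes. As v a = -oo, v is below any - K near a, and half of this bound is carried to z. *)
Lemma u_eq0 z : D z -> cabs z k = 0 -> u z = 0.
Proof.
have [u01 _ ua _] := uS; move=> Dz zk; have /andP[uz0 uz1] := u01 _ Dz.
apply/eqP; rewrite eq_le uz0 andbT leNgt; apply/negP => uzp.
have lnu : ln (u z) < 0 by rewrite ln_lt0// uzp.
(* Half of K is 1 - ln (u z), so the transported bound would read ln (u z) <= ln (u z) - 1. *)
pose K := - (2 * ln (u z)) + 2; have K0 : 0 <= K by rewrite /K; lra.
have [_ [usc _]] := psh_v.
have : (v a < (- K)%:E)%E by rewrite /v ua le0_lneNy// ltNyr.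
move=> /(usc _ aD) va.
have : \forall p \near ((0, 0) : R * R), (v (cline a (vector_to a z) p.1 p.2) < (- K)%:E)%E.
  have := @continuous_line _ _ a (vector_to a z) (0, 0); rewrite /continuous_at /= cline0 => c.
  exact: (c _ va).
move=> /near0_disc[e [e0 e1 eK]].
have h0 : 0 < 1 / 2 :> R by lra.
have h1 : 1 / 2 <= 1 :> R by lra.
have [|R0 [eta [eta0 H]]] := @move_along_line _ _ alpha a (vector_to a z) e (1 / 2) e0 e1 h0 h1.
  by rewrite cline_vector_to; exact: Dz.1.
have key : (v z <= (- ((1 - 1 / 2) * K))%:E)%E.
  rewrite -[X in v X](cline_vector_to a z).
  apply: (H D v K a K0 psh_v v_le0 (fun j _ => conj erefl erefl)).
- move=> p Ap; split.
    move=> j aj; rewrite cabs_neq0; apply: (lt_le_trans eta0).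
    exact: (line_annulusE Ap eta0).
  rewrite zpow_eq0//; move/cabs_eq0 : ak => [ra ia]; move/cabs_eq0 : zk => [rz iz].
  by apply/cabs_eq0; rewrite re_cline im_cline re_vector_to im_vector_to ra ia rz iz !subrr !mulr0
      !addr0 subr0.
- by move=> p pe; apply/ltW/eK; rewrite pe.
by move: key; rewrite /v lne_EFin// lee_fin /K; lra.
Qed.

(** The power is monotone or antitone according to the sign of p; the sum covers both cases. *)
Lemma ler_powR_bounds (c d x p : R) : 0 < c -> c <= x -> x <= d -> x `^ p <= c `^ p + d `^ p.
Proof.
move=> c0 cx xd; have x0 := lt_le_trans c0 cx; have d0 := lt_le_trans x0 xd.
have [p0|p0] := leP 0 p.
  have : x `^ p <= d `^ p by apply: ge0_ler_powR; rewrite // nnegrE ltW.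
  by have := powR_ge0 c p; lra.
have : x `^ p <= c `^ p.
  rewrite -[p]opprK !(powRN _ (- p)) lef_pV2 ?posrE ?powR_gt0//.
  by apply: ge0_ler_powR; rewrite ?nnegrE ?oppr_ge0 ?(ltW p0) ?(ltW x0) ?(ltW c0).
by have := powR_ge0 d p; lra.
Qed.

(** Parameters range over a bounded disc, and the holes keep the bases with negative exponent above
    the square root of eta. The bound does not see the k-th coordinate of z, so it is uniform over
    the slices. *)
Lemma zpow_off_bound z0 w e eta R0 : 0 < eta ->
  exists2 M : R, 0 < M & forall p z, line_annulus alpha z0 w e eta R0 p ->
    (forall j, j != k -> re z j = re z0 j /\ im z j = im z0 j) ->
    zpow_off (cline z w p.1 p.2) <= M.
Proof.
move=> eta0.
pose C j := 2 * (re z0 j ^+ 2 + im z0 j ^+ 2) + 2 * `|R0| * (re w j ^+ 2 + im w j ^+ 2).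
have C0 j : 0 <= C j by rewrite addr_ge0 ?mulr_ge0 ?addr_ge0 ?sqr_ge0.
pose B j := Num.sqrt eta `^ alpha j + (Num.sqrt (eta + C j)) `^ alpha j + 1.
have B0 j : 0 < B j by rewrite ltr_wpDl// addr_ge0 ?powR_ge0.
exists (\prod_(j < n | j != k) B j); first exact: prodr_gt0.
move=> p z Ap zz0; apply: ler_prod => j jk; rewrite powR_ge0 /=.
have [rz iz] := zz0 _ jk.
have le1 : sqabs (cline z w p.1 p.2) j <= C j.
  rewrite sqabs_cline rz iz; apply: sqm_le; case: Ap => h _ _.
  exact: le_trans h (ler_norm _).
have le2 : cabs (cline z w p.1 p.2) j <= Num.sqrt (eta + C j).
  by rewrite cabsE ler_wsqrtr//; lra.
have se0 : 0 < Num.sqrt eta by rewrite sqrtr_gt0.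
have [aj|aj] := ltP (alpha j) 0.
  have : Num.sqrt eta <= cabs (cline z w p.1 p.2) j.
    rewrite cabsE ler_wsqrtr//; have := line_annulusE Ap eta0 aj.
    by rewrite !sqabs_cline rz iz.
  by move=> /(ler_powR_bounds (alpha j) se0) /(_ le2) h; apply: (le_trans h); rewrite lerDl.
have : cabs (cline z w p.1 p.2) j `^ alpha j <= Num.sqrt (eta + C j) `^ alpha j.
  by apply: ge0_ler_powR => //; rewrite nnegrE ?cabs_ge0 ?sqrtr_ge0.
by move=> h; apply: (le_trans h); rewrite /B -addrA addrCA lerDl addr_ge0 ?powR_ge0.
Qed.

Lemma small_powR (M p : R) : 0 < M -> 0 < p ->
  exists2 r : R, 0 < r & forall x, 0 <= x -> x ^+ 2 <= r -> x `^ p * M < 1.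
Proof.
(* x1 is the radius at which x1^p M = exp(-1). *)
move=> M0 p0; pose x1 := expR (- (ln M + 1) / p).
have x10 : 0 < x1 by exact: expR_gt0.
exists (x1 ^+ 2) => [|x x0]; first by rewrite exprn_gt0.
rewrite ler_sqr ?nnegrE ?(ltW x10)// => xx1.
have : x `^ p <= x1 `^ p by apply: ge0_ler_powR; rewrite ?nnegrE ?(ltW p0) ?(ltW x10).
have -> : x1 `^ p = (expR 1 * M)^-1.
  rewrite /powR gt_eqF// expRK -[M in RHS]lnK ?posrE// -expRD -expRN; congr expR.
  by field; rewrite gt_eqF.
move=> h; have E0 : 0 < expR 1 :> R by exact: expR_gt0.
have E1 : 1 < expR 1 :> R by rewrite expR_gt1.
have : x `^ p * M <= (expR 1 * M)^-1 * M by rewrite ler_wpM2r// ltW.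
move=> /le_lt_trans; apply; rewrite invfM -mulrA mulVf ?gt_eqF// mulr1.
by rewrite invf_lt1.
Qed.

(* Compare v on the lines joining a slice through a, where the C^2 condition bounds u by
   C |z_k|^2, with the slice through z. *)
Lemma v_asymptotics z : cabs z k = 0 -> (forall j, alpha j < 0 -> cabs z j != 0) ->
  forall b : R, 0 < b -> b < 1 -> exists r0 M : R, 0 < r0 /\
    forall s t : R, 0 < s ^+ 2 + t ^+ 2 -> s ^+ 2 + t ^+ 2 <= r0 ->
      (v (cline z (e1 k) s t) <= (b * ln (s ^+ 2 + t ^+ 2) + M)%:E)%E.
Proof.
move=> zk nz b b0 b1; have [u01 _ _ uC2] := uS.
have [ra ia] : re a k = 0 /\ im a k = 0 by exact/cabs_eq0.
have [rz iz] : re z k = 0 /\ im z k = 0 by exact/cabs_eq0.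
have [C C0 nearC] := quadratic_bound uC2 ak (fun y Gy => ltac:(by have /andP[] := u01 _ Gy)) u_eq0.
pose w := vector_to a z.
(* Joint continuity in the slice parameter p and the line parameter q gives a radius e independent
   of the slice. *)
have [e [e0 e1' eC]] : exists e : R, [/\ 0 < e, e <= 1 & forall p q : R * R,
    p.1 ^+ 2 + p.2 ^+ 2 <= e -> q.1 ^+ 2 + q.2 ^+ 2 <= e ->
    u (cline (cline a (e1 k) p.1 p.2) w q.1 q.2) <= C * sqabs (cline (cline a (e1 k) p.1 p.2) w q.1
        q.2) k].
  have cg : continuous (fun pq : (R * R) * (R * R) => cline (cline a (e1 k) pq.1.1 pq.1.2) w pq.2.1
      pq.2.2).
    move=> pq; apply: (@continuous_comp _ _ _ (fun pq : (R * R) * (R * R) => (cline a (e1 k) pq.1.1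
        pq.1.2, pq.2))
      (fun p => cline p.1 w p.2.1 p.2.2)); last exact: continuous_cline.
    apply: continuous_at_pair; last exact: cvg_snd.
    apply: (@continuous_comp _ _ _ fst (fun p : R * R => cline a (e1 k) p.1 p.2)); first exact:
        cvg_fst.
    exact: continuous_line.
  have := cg ((0, 0), (0, 0)); rewrite /continuous_at /= !cline0 => /(_ _ nearC).
  move=> [[A B] /= [nA nB] AB].
  have [eA [eA0 eA1 hA]] := near0_disc nA; have [eB [eB0 eB1 hB]] := near0_disc nB.
  exists (Num.min eA eB); rewrite lt_min eA0 eB0 ge_min eA1; split=> // p q.
  rewrite !le_min => /andP[pA _] /andP[_ qB].
  by apply: (AB (p, q)); split; [exact: hA|exact: hB].
have d0 : 0 < 1 - b by lra.
have d1 : 1 - b <= 1 by lra.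
have [|R0 [eta [eta0 H]]] := @move_along_line _ _ alpha a w e (1 - b) e0 e1' d0 d1.
  by rewrite cline_vector_to.
have [M M0 hM] := @zpow_off_bound a w e eta R0 eta0.
have [r1 r10 hr1] := small_powR M0 ak0.
(* The three bounds put the slice where the quadratic bound holds, keep the line in D, and give C N
   <= 1, so that K = - ln (C N) is nonnegative. The result - b K is b ln N + b ln C. *)
exists (Num.min (Num.min e r1) C^-1), (b * ln C).
split; first by rewrite !lt_min e0 r10 invr_gt0.
move=> s t st0; rewrite !le_min => /andP[/andP[se sr] sC].
pose N := s ^+ 2 + t ^+ 2; have CN0 : 0 < C * N by rewrite mulr_gt0.
have CN1 : C * N <= 1 by rewrite mulrC -ler_pdivlMr// div1r.
pose K := - ln (C * N); have K0 : 0 <= K by rewrite oppr_ge0 ln_le0.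
have coordk q1 q2 : sqabs (cline (cline a (e1 k) s t) w q1 q2) k = N.
  by rewrite sqabs_cline re_e1 im_e1 eqxx re_vector_to im_vector_to ra ia rz iz !subrr /sqm !mulr0
      !addr0 !subr0 !add0r.
(* Base point and target are shifted by the same multiple of e1 k; the direction w is unchanged and
   |z_k|^2 = N on the whole line. *)
have -> : cline z (e1 k) s t = cline (cline a (e1 k) s t) w 1 0.
  rewrite /w -[in LHS](cline_vector_to a z) /cline /=; congr pair; apply/rowP => i; rewrite !mxE;
      ring.
have -> : b * ln N + b * ln C = - ((1 - (1 - b)) * K) by rewrite /K lnM ?posrE//; ring.
apply: (H D v K _ K0 psh_v v_le0).
- move=> j aj; have jk : j != k by apply: contraTneq aj => ->; rewrite -leNgt ltW.
  by rewrite re_e1 im_e1 (negbTE jk).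
- move=> p Ap; split.
    move=> j aj; rewrite cabs_neq0; apply: (lt_le_trans eta0).
    have jk : j != k by apply: contraTneq aj => ->; rewrite -leNgt ltW.
    have := line_annulusE Ap eta0 aj.
    by rewrite !sqabs_cline re_e1 im_e1 (negbTE jk).
  rewrite zpowE; set x := cabs _ k.
  have x2 : x ^+ 2 = N by rewrite sqr_cabs coordk.
  apply: le_lt_trans (hr1 x _ _); [|exact: cabs_ge0|by rewrite x2].
  apply: ler_wpM2l; first exact: powR_ge0.
  by apply: (hM p) => // j jk; rewrite re_e1 im_e1 (negbTE jk).
- move=> p pe; have := eC (s, t) p se; rewrite /= pe => /(_ (lexx _)); rewrite coordk => uN.
  rewrite /v /K opprK; set x := u _ in uN *.
  have [x0|x0] := ltP 0 x; first by rewrite lne_EFin// lee_fin ler_ln ?posrE.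
  by rewrite le0_lneNy ?leNye// lee_fin.
Qed.

(** By contradiction, with y' strictly between the claimed bound X and y. The radius |z_k| / y' is
    below the critical one, so the whole closed disc less its centre lies in D, and [log_slope]
    gives u z <= y'^2 < y^2. This also covers [zpow_off z = 0], where the critical radius is
    infinite. *)
Lemma sqrt_u_le z : D z -> Num.sqrt (u z) <= zpow alpha z `^ (alpha k)^-1.
Proof.
move=> Dz; have [u01 _ _ _] := uS; have /andP[uz0 uz1] := u01 _ Dz.
have [zk|/eqP zk] := eqVneq (cabs z k) 0; first by rewrite u_eq0// sqrtr0 powR_ge0.
rewrite leNgt; apply/negP => lt; set X := zpow alpha z `^ _ in lt.
have X0 : 0 <= X by exact: powR_ge0.
set y := Num.sqrt (u z) in lt; have y2 : y ^+ 2 = u z by rewrite sqr_sqrtr.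
have y1 : y < 1.
  by rewrite -(@ltr_sqr _ y 1) ?nnegrE ?sqrtr_ge0// y2 expr1n.
pose y' := (X + y) / 2; have [Xy' y'y] : X < y' /\ y' < y by rewrite /y'; split; lra.
have y'0 : 0 < y' by exact: le_lt_trans Xy'.
have zkp : 0 < cabs z k by rewrite lt_neqAle eq_sym cabs_ge0 andbT; exact/eqP.
pose rho := cabs z k / y'; have rho0 : 0 < rho by rewrite divr_gt0.
(* The projection of z to {z_k = 0}; z itself is the point of the slice with parameter z_k. *)
pose z' := cline z (e1 k) (- re z k) (- im z k).
have z'E s t : cline z' (e1 k) s t = cline z (e1 k) (s - re z k) (t - im z k).
  by rewrite cline_add addrC (addrC _ t).
have offE s t : zpow_off (cline z' (e1 k) s t) = zpow_off z.
  apply: eq_bigr => j jk; congr (_ `^ _).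
  by rewrite z'E !cabsE /sqabs re_e1 im_e1 (negbTE jk).
have kE s t : sqabs (cline z' (e1 k) s t) k = s ^+ 2 + t ^+ 2.
  by rewrite z'E /sqabs re_e1 im_e1 eqxx !(addrC _ (_ - _)) !subrK.
have z'k : cabs z' k = 0.
  by apply/cabs_eq0; rewrite re_e1 im_e1 eqxx !subrr.
have z'n j : alpha j < 0 -> cabs z' j != 0.
  move=> aj; have jk : j != k by apply: contraTneq aj => ->; rewrite -leNgt ltW.
  by rewrite cabsE /sqabs re_e1 im_e1 (negbTE jk); exact: Dz.1.
have rho1 : rho `^ alpha k * zpow_off z < 1.
  have -> : rho `^ alpha k * zpow_off z = zpow alpha z / y' `^ alpha k.
    rewrite zpowE /rho powRM ?invr_ge0 ?cabs_ge0 ?(ltW y'0)// -(powR_inv1 (ltW y'0)) -powRrM mulN1r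
        powRN.
    by rewrite mulrAC.
  rewrite ltr_pdivrMr ?powR_gt0// mul1r.
  have -> : zpow alpha z = X `^ alpha k by rewrite /X -powRrM mulVf ?powRr1 ?zpow_ge0// gt_eqF.
  by apply: gt0_ltr_powR; rewrite ?nnegrE// ltW.
pose K := [set p : R * R | 0 < p.1 ^+ 2 + p.2 ^+ 2 <= rho ^+ 2].
have KD p : K p -> D (cline z' (e1 k) p.1 p.2).
  move=> /andP[p0 pR]; split.
    move=> j aj; have jk : j != k by apply: contraTneq aj => ->; rewrite -leNgt ltW.
    by rewrite cabsE /sqabs re_e1 im_e1 (negbTE jk); exact: z'n.
  rewrite zpowE offE; apply: le_lt_trans rho1; apply: ler_wpM2r; first exact: zpow_off_ge0.
  apply: ge0_ler_powR; rewrite ?nnegrE ?cabs_ge0 ?(ltW ak0) ?(ltW rho0)//.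
  by rewrite -(@ler_sqr _ _ rho) ?nnegrE ?cabs_ge0 ?(ltW rho0)// sqr_cabs kE.
have [uscf subf] := psh_slice psh_v KD.
have sl b : 0 < b -> b < 1 -> exists r0 M : R, 0 < r0 /\
     forall p, K p -> p.1 ^+ 2 + p.2 ^+ 2 <= r0 ->
       (v (cline z' (e1 k) p.1 p.2) <= (b * ln (p.1 ^+ 2 + p.2 ^+ 2) + M)%:E)%E.
  move=> b0 b1; have [r0 [M [r00 h]]] := v_asymptotics z'k z'n b0 b1.
  by exists r0, M; split=> // p /andP[p0 _] pr; exact: h.
have Kz : K (re z k, im z k).
  rewrite /K /= -/(sqabs z k) -cabs_neq0 gt_eqF//= -sqr_cabs ler_sqr ?nnegrE ?cabs_ge0 ?(ltW
      rho0)//.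
  by rewrite /rho ler_pdivlMr// ler_piMr ?cabs_ge0// ltW// (lt_trans y'y).
have := log_slope uscf (fun p Kp => v_le0 (KD p Kp)) subf sl Kz.
rewrite /= z'E !subrr cline0 -/(sqabs z k) -sqr_cabs.
have uzp : 0 < u z by rewrite -y2 exprn_gt0// (le_lt_trans X0).
rewrite /v lne_EFin// lee_fin -ln_div ?posrE ?exprn_gt0// ler_ln ?posrE ?divr_gt0 ?exprn_gt0//.
rewrite -expr_div_n /rho invf_div mulrC mulfVK ?gt_eqF// -y2 ler_sqr ?nnegrE ?sqrtr_ge0 ?(ltW
    y'0)//.
by rewrite leNgt y'y.
Qed.

End upper_bound.

(** * Continuity of powers and decreasing limits under circle means *)

Section continuity_of_powers.
Context {R : realType}.

Lemma continuous_at_powR (T : topologicalType) (q : T -> R) (p : R) (x : T) :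
  (forall y, 0 <= q y) -> {for x, continuous q} -> 0 < q x \/ 0 <= p ->
  {for x, continuous (fun y => q y `^ p)}.
Proof.
move=> q0 cq qp; have [qx|qx] := ltP 0 (q x).
  apply: (@continuous_comp _ _ _ q (fun y => y `^ p)) => //.
  apply/differentiable_continuous/derivable1_diffP.
  exact: (@ex_derive _ _ _ _ _ _ _ (is_derive1_powR p qx)).
have {qp qx} [qx p0] : q x = 0 /\ 0 <= p.
  have qE : q x = 0 by apply/eqP; rewrite eq_le qx q0.
  by case: qp => // h; rewrite qE ltxx in h.
(* The zeroth power is 1 even at 0, so it is constant. *)
have [->|pn0] := eqVneq p 0.
  rewrite (_ : (fun y => _) = cst 1); first exact: cst_continuous.
  by apply/funext => y; rewrite powRr0.
have {pn0} p0 : 0 < p by rewrite lt_neqAle eq_sym pn0.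
change (q y `^ p @[y --> x] --> q x `^ p); rewrite qx powR0 ?gt_eqF//.
apply/cvgr0Pnorm_lt => e e0.
have e'0 : 0 < e `^ p^-1 by exact: powR_gt0.
have : q y @[y --> x] --> q x := cq; rewrite qx => /cvgr_lt /(_ _ e'0).
apply: filterS => y qy; rewrite ger0_norm ?powR_ge0//.
have -> : e = (e `^ p^-1) `^ p by rewrite -powRrM mulVf ?powRr1 ?(ltW e0)// gt_eqF.
by apply: gt0_ltr_powR; rewrite ?nnegrE// ltW.
Qed.

Lemma continuous_at_bigprod (I : Type) (l : seq I) (T : topologicalType) (g : I -> T -> R) (x : T) :
  (forall i, {for x, continuous (g i)}) ->
  {for x, continuous (fun y => \prod_(i <- l) g i y)}.
Proof.
move=> cg; elim: l => [|i l IH].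
  rewrite (_ : (fun y => _) = cst 1); first exact: cst_continuous.
  by apply/funext => y; rewrite big_nil.
rewrite (_ : (fun y => _) = g i \* (fun y => \prod_(j <- l) g j y)).
  by apply: cvgM; [exact: cg|exact: IH].
by apply/funext => y; rewrite big_cons.
Qed.

Lemma powR_prod (I : Type) (l : seq I) (f : I -> R) (p : R) : (forall i, 0 <= f i) ->
  (\prod_(i <- l) f i) `^ p = \prod_(i <- l) f i `^ p.
Proof.
move=> f0; elim: l => [|i l IH]; first by rewrite !big_nil powR1.
by rewrite !big_cons powRM ?IH// prodr_ge0.
Qed.

Lemma cvg_lne (x : R ^nat) (l : R) : (forall n, 0 < x n) -> 0 <= l ->
  x n @[n --> \oo] --> l -> (ln (x n))%:E @[n --> \oo] --> lne l%:E.
Proof.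
move=> x0; rewrite le_eqVlt => /predU1P[<-|l0] xl; last first.
  rewrite lne_EFin//; apply: cvg_EFin; first by near=> n.
  by apply: (continuous_cvg _ (continuous_ln l0)).
rewrite le0_lneNy//; apply/cvgeNyPler => A _.
have := xl => /cvgr_lt /(_ _ (expR_gt0 A)); apply: filterS => n xn.
by rewrite lee_fin -(expRK A) ler_ln ?posrE ?expR_gt0// ltW.
Unshelve. all: by end_near.
Qed.

(** Monotone convergence for B - h n, where B bounds h 0 and hence every h n. The limit f may take
    the value -oo, so no integrable lower bound is at hand. *)
Lemma mean_decreasing_limit (h : nat -> R -> R) (f : R -> \bar R) (L : R) :
  (forall n, continuous (h n)) -> (forall th n m, (n <= m)%N -> h m th <= h n th) ->
  (forall th, (h n th)%:E @[n --> \oo] --> f th) -> (forall th, (f th <= 0)%E) ->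
  (forall n, L <= (2 * pi)^-1 * itv_integral (h n) 0 (2 * pi)) ->
  (L%:E <= circle_mean f)%E.
Proof.
move=> ch dh hf f0 hL; have p0 := @pi2_ge0 R.
have pp : 0 < 2 * pi :> R by rewrite mulr_gt0// pi_gt0.
have [c cin cmax] := @EVT_max R (h 0%N) 0 (2 * pi) p0 (continuous_subspaceT (ch 0%N)).
pose B := `|h 0%N c|; have B0 : 0 <= B by exact: normr_ge0.
pose D : set (measurableTypeR R) := `[0, 2 * pi]%classic.
have mD : measurable D by exact: measurable_itv.
have hB n th : D th -> h n th <= B.
  move=> Dth; apply: (le_trans (dh th 0%N n _)) => //.
  by apply: le_trans (ler_norm _); apply: cmax.
have mh n : measurable_fun D (EFin \o h n).
  apply/measurable_EFinP; apply: measurable_funTS.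
  apply: continuous_measurable_fun.
  exact: ch.
have mf : measurable_fun D f.
  by apply: (emeasurable_fun_cvg (fun n (th : R) => (h n th)%:E)) => // th _; exact: hf.
pose g n (th : R) := (B - h n th)%:E.
have mg n : measurable_fun D (g n).
  apply/measurable_EFinP; apply: measurable_funTS; apply: continuous_measurable_fun => th.
  by apply: cvgB; [exact: cvg_cst|exact: ch].
have g0 n th : D th -> (0 <= g n th)%E by move=> Dth; rewrite lee_fin subr_ge0 hB.
have homg th : D th -> {homo g^~ th : n m / (n <= m)%N >-> (n <= m)%E}.
  by move=> _ n m nm; rewrite lee_fin lerB// dh.
have glim th : limn (g^~ th) = (B%:E + - f th)%E.
  apply/cvg_lim => //; rewrite /g; under eq_fun do rewrite EFinB.
  by apply: cvgeB; [exact: fin_num_adde_defr|exact: cvg_cst|exact: hf].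
have Ig n : (\int[lebesgue_measure]_(th in D) g n th <= (2 * pi * (B - L))%:E)%E.
  have -> : (\int[lebesgue_measure]_(th in D) g n th = (itv_integral (fun th => B - h n th) 0 (2 *
      pi))%:E)%E.
    rewrite /itv_integral /Rintegral fineK//; apply: integrable_fin_num => //.
    by apply: continuous_integrable_itv => th; apply: cvgB; [exact: cvg_cst|exact: ch].
  have cB : continuous (fun _ : R => B) by move=> ?; exact: cvg_cst.
  have cN : continuous (fun th => -1 * h n th) by move=> th; apply: cvgM; [exact: cvg_cst|exact:
      ch].
  rewrite (_ : itv_integral _ _ _ = itv_integral (fun th => B + -1 * h n th) 0 (2 * pi)); last
      first.
    by apply: eq_Rintegral => th _; rewrite mulN1r.
  rewrite (itv_integralD _ _ cB cN) (itv_integralZ _ _ _ (ch n)) itv_integral_cst// lee_fin.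
  by have := hL n; rewrite mulrC ler_pdivlMr//; lra.
have cvgI := cvg_monotone_convergence mD mg g0 homg.
have le_lim : (\int[lebesgue_measure]_(th in D) (B%:E + - f th) <= (2 * pi * (B - L))%:E)%E.
  under eq_integral do rewrite -glim.
  rewrite (monotone_convergence _ mD mg g0 homg).
  apply: lime_le; first exact: (cvgP _ (cvgI _)).
  by near=> n; exact: Ig.
have f0' th : D th -> (0 <= - f th)%E by rewrite oppe_ge0.
rewrite ge0_integralD// in le_lim; last exact: measurableT_comp.
have IB : (\int[lebesgue_measure]_(th in D) B%:E = (2 * pi * B)%:E)%E.
  apply: (etrans (integral_cst _ mD _)).
  transitivity (B%:E * (2 * pi)%:E)%E; last by rewrite -EFinM mulrC.
  congr (_ * _)%E.
  apply: (etrans (lebesgue_measure_itv `[0, 2 * pi])); rewrite /= lte_fin pp.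
  by rewrite -EFinD subr0.
have IfN : (\int[lebesgue_measure]_(th in D) - f th <= (- (2 * pi * L))%:E)%E.
  move: le_lim; rewrite IB.
  have -> : (2 * pi * (B - L))%:E = ((2 * pi * B)%:E + (- (2 * pi * L))%:E)%E.
    by rewrite -EFinD; congr EFin; ring.
  by rewrite leeD2lE.
rewrite /circle_mean (_ : L = (2 * pi)^-1 * (2 * pi * L)) ?EFinM; last by rewrite mulKf// gt_eqF.
apply: lee_wpmul2l; first by rewrite lee_fin invr_ge0.
have -> : (\int[lebesgue_measure]_(th in `[0%R, (2 * pi)%R]) f th =
   - \int[lebesgue_measure]_(th in D) - f th)%E.
  by rewrite -integral_ge0N//; apply: eq_integral => th _; rewrite oppeK.
by rewrite leeNr -EFinN.
Unshelve. all: by end_near.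
Qed.

End continuity_of_powers.

(** * Plurisubharmonicity of the logarithm of the competitor *)

Section log_psh.
Context {R : realType} {n : nat}.
Variables (alpha : 'I_n -> R) (m : R).
Hypothesis m0 : 0 < m.
Implicit Types (y z w : Cn R n) (j : 'I_n).

(** The squared moduli are polynomials, so a vanishing factor is smooth enough once its exponent
    alpha j / m is at least 1. *)
Definition zpow_sq z := \prod_(j < n) (sqabs z j `^ (alpha j / m)).

Lemma zpow_sq_ge0 z : 0 <= zpow_sq z.
Proof. by apply: prodr_ge0 => j _; exact: powR_ge0. Qed.

Lemma sqrt_zpow_sq z : Num.sqrt (zpow_sq z) = zpow alpha z `^ m^-1.
Proof.
rewrite -(@powR12_sqrt R (zpow_sq z) (zpow_sq_ge0 z)) /zpow_sq /zpow.
rewrite (@powR_prod R _ _ (fun j => sqabs z j `^ (alpha j / m)) 2^-1); last by move=> j; exact: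
    powR_ge0.
rewrite (@powR_prod R _ _ (fun j => cabs z j `^ alpha j) m^-1); last by move=> j; exact: powR_ge0.
apply: eq_bigr => j _; rewrite cabsE -(@powR12_sqrt R _ (sqabs_ge0 z j)) -!powRrM.
by congr (_ `^ _); rewrite mulrC.
Qed.

Lemma zpow_sq_lt1 z : Dalpha alpha z -> zpow_sq z < 1.
Proof.
move=> [_ z1]; have : Num.sqrt (zpow_sq z) < 1.
  have e1 : (1 : R) `^ m^-1 = 1 by rewrite powR1.
  rewrite sqrt_zpow_sq -[ltRHS]e1; apply: gt0_ltr_powR; rewrite ?invr_gt0 ?nnegrE ?zpow_ge0//.
by rewrite -[X in _ < X -> _]sqrtr1 ltr_sqrt.
Qed.

Lemma continuous_zpow_sq z : (forall j, alpha j < 0 -> cabs z j != 0) -> {for z, continuous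
    zpow_sq}.
Proof.
move=> nz; apply: continuous_at_bigprod => j.
apply: continuous_at_powR; [by move=> y; exact: sqabs_ge0|exact: continuous_sqabs|].
have [aj|aj] := ltP (alpha j) 0; first by left; rewrite -cabs_neq0 nz.
by right; rewrite divr_ge0// ltW.
Qed.

Lemma usc_lne_zpow_sq z : (forall j, alpha j < 0 -> cabs z j != 0) ->
  usc_at (fun z => lne (zpow_sq z)%:E) z.
Proof.
move=> nz c; have ltE x : 0 <= x -> (lne x%:E < c%:E)%E = (x < expR c).
  rewrite le_eqVlt => /predU1P[<-|x0]; first by rewrite le0_lneNy// ltNyr expR_gt0.
  by rewrite lne_EFin// lte_fin -[X in _ < X = _]expRK ltr_ln ?posrE ?expR_gt0.
rewrite ltE ?zpow_sq_ge0// => zc.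
have : \forall y \near z, zpow_sq y < expR c.
  by have := continuous_zpow_sq nz => /(@cvgr_lt _ _ _ _ _ (zpow_sq z)) /(_ _ zc).
by apply: filterS => y yc; rewrite ltE ?zpow_sq_ge0.
Qed.

(** On D a base with nonzero exponent can vanish only if alpha j > 0. Adding e to these bases alone
    keeps the sum finite and makes it increase with e; with a negative coefficient the monotonicity
    would be reversed. *)
Let smooth z (e : R) := \sum_(j < n) alpha j / m * ln (sqabs z j + (if 0 < alpha j then e else 0)).

Lemma base_gt0 z j e : (forall j, alpha j < 0 -> cabs z j != 0) -> 0 < e -> alpha j != 0 ->
  0 < sqabs z j + (if 0 < alpha j then e else 0).
Proof.
move=> nz e0 aj; case: ifPn => [_|]; first by rewrite ltr_wpDl// sqabs_ge0.
rewrite -leNgt => a0; rewrite addr0 -cabs_neq0 nz// lt_neqAle aj.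
by [].
Qed.

Lemma smooth_le z e e' : (forall j, alpha j < 0 -> cabs z j != 0) -> 0 < e -> e <= e' ->
  smooth z e <= smooth z e'.
Proof.
move=> nz e0 ee; apply: ler_sum => j _.
have [aj|aj] := boolP (0 < alpha j); last by rewrite lexx.
apply: ler_wpM2l; first by rewrite divr_ge0// ltW.
have p0 : 0 < sqabs z j + e by rewrite ltr_wpDl// sqabs_ge0.
by rewrite ler_ln ?posrE ?lerD2l//; apply: (lt_le_trans p0); rewrite lerD2l.
Qed.

(** The limit may be -oo, so convergence is proved for the exponential, a product of powers
    continuous at e = 0. *)
Lemma smooth_cvg z : (forall j, alpha j < 0 -> cabs z j != 0) ->
  (smooth z k.+1%:R^-1)%:E @[k --> \oo] --> lne (zpow_sq z)%:E.
Proof.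
move=> nz; pose x k := expR (smooth z k.+1%:R^-1).
rewrite (_ : (fun k => _) = (fun k => (ln (x k))%:E)); last by apply/funext => k; rewrite /x expRK.
apply: cvg_lne; [by move=> k; exact: expR_gt0|exact: zpow_sq_ge0|].
(* Absolute values make the bases nonnegative for every real e, so that continuity at 0 can be
   two-sided. *)
pose U (e : R) := \prod_(j < n) ((`|sqabs z j + (if 0 < alpha j then e else 0)|) `^ (alpha j / m)).
have -> : x = U \o (fun k => k.+1%:R^-1).
  apply/funext => k; rewrite /x /smooth expR_sum /U /=; apply: eq_bigr => j _.
  have [->|aj] := eqVneq (alpha j) 0; first by rewrite mul0r mul0r expR0 powRr0.
  have k0 : 0 < k.+1%:R^-1 :> R by rewrite invr_gt0.
  have b0 := base_gt0 nz k0 aj.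
  by rewrite gtr0_norm// /powR gt_eqF// mulrC.
have U0 : U 0 = zpow_sq z.
  by apply: eq_bigr => j _; rewrite if_same addr0 ger0_norm ?sqabs_ge0.
suff cU : {for (0 : R), continuous U} by rewrite -U0; exact: (continuous_cvg _ cU (@cvg_harmonic
    R)).
apply: continuous_at_bigprod => j; apply: continuous_at_powR.
- by move=> y; exact: normr_ge0.
- apply: (continuous_comp _ (@norm_continuous _ _ _)).
  by apply: cvgD; [exact: cvg_cst|case: ifP => _; [exact: cvg_id|exact: cvg_cst]].
- have [aj|aj] := ltP (alpha j) 0.
    by left; rewrite if_same addr0 ger0_norm ?sqabs_ge0// -cabs_neq0 nz.
  by right; rewrite divr_ge0// ltW.
Qed.

(** At a zero of the competitor nothing is to be shown. Elsewhere the sub-mean inequality is checked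
    term by term for [smooth], and e decreases to 0. *)
Lemma psh_zpow_sq : psh (Dalpha alpha) (fun z => lne (zpow_sq z)%:E).
Proof.
split; first by move=> z _; rewrite /=; case: ifP.
split; first by move=> z [nz _]; exact: usc_lne_zpow_sq.
move=> z w r Dz r0 disc.
have oncirc th : (r * cos th) ^+ 2 + (r * sin th) ^+ 2 <= r ^+ 2.
  by rewrite !exprMn -mulrDr cos2Dsin2 mulr1.
have [u0|u0] := ltP 0 (zpow_sq z); last by rewrite le0_lneNy ?leNye// lee_fin.
rewrite lne_EFin//.
have nzc th : forall j, alpha j < 0 -> cabs (cline z w (r * cos th) (r * sin th)) j != 0.
  by move=> j aj; exact: (disc _ _ (oncirc th)).1.
have nz j : alpha j != 0 -> 0 < sqabs z j.
  move=> aj; rewrite lt_neqAle sqabs_ge0 andbT eq_sym; apply: contraTneq u0 => z0.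
  by rewrite /zpow_sq (bigD1 j)//= z0 powR0 ?mul0r ?ltxx// mulf_neq0// invr_neq0// gt_eqF.
pose h k th := smooth (cline z w (r * cos th) (r * sin th)) k.+1%:R^-1.
pose T j e th := alpha j / m * ln (sqm (re z j) (im z j) (re w j) (im w j) (0 + r * cos th) (0 + r
    * sin th) + (if 0 < alpha j then e else 0)).
have hE k : h k = (fun th => \sum_(j < n) T j k.+1%:R^-1 th).
  by apply/funext => th; apply: eq_bigr => j _; rewrite /T sqabs_cline !add0r.
have k0 k : 0 < k.+1%:R^-1 :> R by rewrite invr_gt0.
have cT j e : 0 < e -> continuous (T j e).
  move=> e0; have [aj|aj] := eqVneq (alpha j) 0.
    rewrite (_ : T j e = cst 0); first exact: cst_continuous.
    by apply/funext => th; rewrite /T aj !mul0r.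
  move=> th; apply: cvgM; first exact: cvg_cst.
  apply: (@continuous_ln_comp R (fun th => _ + _)) => [|t].
    by move=> t; apply: cvgD; [exact: continuous_circle|exact: cvg_cst].
  by have := base_gt0 (nzc t) e0 aj; rewrite sqabs_cline !add0r.
have mT j e : 0 < e -> 2 * pi * (alpha j / m * ln (sqabs z j)) <= itv_integral (T j e) 0 (2 * pi).
  move=> e0; have [aj|aj] := eqVneq (alpha j) 0.
    rewrite aj !mul0r mulr0 (_ : T j e = fun=> 0); first by rewrite itv_integral_cst ?pi2_ge0//
        mul0r.
    by apply/funext => th; rewrite /T aj !mul0r.
  have clog : continuous (fun th => ln (sqm (re z j) (im z j) (re w j) (im w j) (0 + r * cos th) (0
      + r * sin th) + (if 0 < alpha j then e else 0))).
    apply: (@continuous_ln_comp R (fun th => _ + _)) => [|t].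
      by move=> t; apply: cvgD; [exact: continuous_circle|exact: cvg_cst].
    by have := base_gt0 (nzc t) e0 aj; rewrite sqabs_cline !add0r.
  have zE : sqabs z j = sqm (re z j) (im z j) (re w j) (im w j) 0 0 by rewrite sqm0.
  rewrite /T (itv_integralZ _ _ _ clog) mulrCA.
  have [ap|an] := boolP (0 < alpha j).
    apply: ler_wpM2l; first by rewrite divr_ge0// ltW.
    by rewrite zE; apply: mean_ln_sqmD_ge => //; rewrite -zE nz.
  have an' : alpha j < 0 by rewrite lt_neqAle aj leNgt.
  (* A negative coefficient would reverse an inequality, so equality is needed; it holds because the
     j-th coordinate has no zero on a disc contained in D. *)
  rewrite (_ : itv_integral _ _ _ = 2 * pi * ln (sqabs z j))//.
  rewrite zE -(@mean_ln_sqm _ _ _ _ _ 0 0 r).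
    by apply: eq_Rintegral => th _; rewrite addr0.
  apply: sqm_disc_nonvanishing; first exact: ltW.
  move=> s t st; rewrite !add0r -sqabs_cline gt_eqF// -cabs_neq0.
  exact: (disc _ _ st).1.
apply: (@mean_decreasing_limit R h).
- by move=> k; rewrite hE; apply: continuous_bigsum => j; exact: cT.
- move=> th k l kl; apply: smooth_le => //; first exact: nzc.
  by rewrite lef_pV2 ?posrE// ler_nat.
- by move=> th; apply: smooth_cvg; exact: nzc.
- by move=> th; rewrite lne_le0 lee_fin ltW// zpow_sq_lt1//; exact: disc.
- move=> k; rewrite hE (itv_integral_sum _ (fun j => cT j _ (k0 k)))// ?pi2_ge0//.
  have pp : 0 < 2 * pi :> R by rewrite mulr_gt0// pi_gt0.
  rewrite mulrC ler_pdivlMr// mulrC.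
  have -> : ln (zpow_sq z) = \sum_(j < n) alpha j / m * ln (sqabs z j).
    rewrite /zpow_sq -[RHS]expRK expR_sum; congr ln; apply: eq_bigr => j _.
    have [->|aj] := eqVneq (alpha j) 0; first by rewrite !mul0r powRr0 expR0.
    by rewrite /powR gt_eqF// nz.
  by rewrite mulr_sumr; apply: ler_sum => j _; exact: mT.
Qed.

End log_psh.

(** * Functions of class C^2 with explicit directional derivatives *)

Section twice_differentiable.
Context {R : realType} {V : normedModType R}.
Implicit Types (f g : V -> R) (x v w : V) (U : set V).

(** The derivatives are carried as data, so that the product rule can be iterated over a finite
    product. *)
Record C2_on U f (f1 : V -> V -> R) (f2 : V -> V -> V -> R) : Prop := C2On {
  C2_cont : forall x, U x -> {for x, continuous f};
  C2_cont1 : forall v x, U x -> {for x, continuous (f1 v)};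
  C2_cont2 : forall v w x, U x -> {for x, continuous (f2 v w)};
  C2_deriv1 : forall v x, U x -> is_derive x v f (f1 v x);
  C2_deriv2 : forall v w x, U x -> is_derive x w (f1 v) (f2 v w x) }.

Lemma C2_on_mul U f (f1 : V -> V -> R) (f2 : V -> V -> V -> R) g
    (g1 : V -> V -> R) (g2 : V -> V -> V -> R) : C2_on U f f1 f2 -> C2_on U g g1 g2 ->
  C2_on U (f \* g) (fun v x => f1 v x * g x + f x * g1 v x)
    (fun v w x => f2 v w x * g x + f1 v x * g1 w x + (f1 w x * g1 v x + f x * g2 v w x)).
Proof.
move=> [cf cf1 cf2 df1 df2] [cg cg1 cg2 dg1 dg2]; split=> [x Ux|v x Ux|v w x Ux|v x Ux|v w x Ux].
- by apply: cvgM; [exact: cf|exact: cg].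
- by apply: cvgD; apply: cvgM; [exact: cf1|exact: cg|exact: cf|exact: cg1].
- apply: cvgD; apply: cvgD; apply: cvgM; by [exact: cf2|exact: cg|exact: cf1|exact: cg1|exact:
    cf|exact: cg2].
- apply: (is_derive_eq (is_deriveM (df1 v x Ux) (dg1 v x Ux))).
  by rewrite /GRing.scale /=; ring.
- apply: (is_derive_eq (is_deriveD (is_deriveM (df2 v w x Ux) (dg1 w x Ux)) (is_deriveM (df1 w x
    Ux) (dg2 v w x Ux)))); rewrite /GRing.scale /=; ring.
Qed.

Lemma C2_on_cst U (c : R) : C2_on U (fun=> c) (fun _ _ => 0) (fun _ _ _ => 0).
Proof.
by split=> *; first [exact: cvg_cst|exact: is_derive_cst].
Qed.

Lemma C2_on_prod U (I : Type) (l : seq I) (f : I -> V -> R) :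
  (forall i, exists (f1 : V -> V -> R) (f2 : V -> V -> V -> R), C2_on U (f i) f1 f2) ->
  exists (f1 : V -> V -> R) (f2 : V -> V -> V -> R), C2_on U (fun x => \prod_(i <- l) f i x) f1 f2.
Proof.
move=> Cf; elim: l => [|i l [g1 [g2 Cg]]].
  exists (fun _ _ => 0), (fun _ _ _ => 0).
  rewrite (_ : (fun x => _) = (fun=> 1)); first exact: C2_on_cst.
  by apply/funext => x; rewrite big_nil.
have [f1 [f2 Cfi]] := Cf i; do 2!eexists.
rewrite (_ : (fun x => _) = f i \* (fun x => \prod_(j <- l) f j x)).
  exact: C2_on_mul Cfi Cg.
by apply/funext => x; rewrite big_cons.
Qed.

Lemma is_derive_lineE f x v d :
  is_derive (0 : R) 1 (fun t : R => f (x + t *: v)) d <-> is_derive x v f d.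
Proof.
have E : (fun h : R => h^-1 *: (((fun t : R => f (x + t *: v)) \o shift 0) (h *: (1 : R)) - f (x +
    0 *: v))) =
   (fun h : R => h^-1 *: ((f \o shift x) (h *: v) - f x)).
  apply/funext => h /=; rewrite scale0r !addr0; congr (_ *: (f _ - _)).
  by rewrite [h *: 1]mulr1 addrC.
split=> [[h1 h2]|[h1 h2]].
  by apply: DeriveDef; [rewrite /derivable -E|rewrite /derive -E].
have h0 : derivable f (x + 0 *: v) v by rewrite scale0r addr0.
by have := is_derive_line h0; rewrite scale0r addr0 h2.
Qed.

Lemma is_derive_affine (a b s : R) : is_derive s 1 (fun t : R => a + t * b) b.
Proof.
apply: (is_derive_eq (is_deriveD (is_derive_cst a s 1) (is_deriveM (is_derive_id s 1)
    (is_derive_cst b s 1)))).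
by rewrite /GRing.scale /= add0r mulr0 add0r mulr1.
Qed.

Lemma is_derive_powR f x v d (p : R) : 0 < f x -> is_derive x v f d ->
  is_derive x v (fun y => f y `^ p) (p * f x `^ (p - 1) * d).
Proof.
move=> f0 /is_derive_lineE df; apply/is_derive_lineE.
have f0' : 0 < f (x + 0 *: v) by rewrite scale0r addr0.
have := is_derive1_comp (is_derive1_powR p f0') df.
by rewrite scale0r addr0.
Qed.

(* a factor that is merely continuous can be differentiated where the other factor vanishes *)
Lemma is_derive_mul_eq0 f g x v d : is_derive x v f d -> f x = 0 ->
  {for x, continuous g} -> is_derive x v (fun y => f y * g y) (d * g x).
Proof.
move=> [df fd] fx cg.
have : h^-1 *: (((fun y => f y * g y) \o shift x) (h *: v) - f x * g x) @[h --> (0 : R)^'] --> d *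
    g x.
  have cgl : g (h *: v + x) @[h --> (0 : R)^'] --> g x.
    apply: (@cvg_comp _ _ _ (fun h : R => h *: v + x) g _ (nbhs x)); last exact: cg.
    apply: cvg_within_filter; rewrite -[X in _ --> nbhs X]add0r -[X in _ --> nbhs (X + _)](scale0r
        v).
    by apply: cvgD; [apply: cvgZr_tmp; exact: cvg_id|exact: cvg_cst].
  rewrite -fd; apply: cvg_trans (cvgM df cgl).
  apply: near_eq_cvg; near=> h; rewrite /= fx mul0r !subr0.
  by rewrite /GRing.scale /= mulrA.
move=> lim; apply: DeriveDef; first by apply/cvg_ex; exists (d * g x).
exact: cvg_lim.
Unshelve. all: by end_near.
Qed.

End twice_differentiable.

(** Since U is open, f1 and f2 agree with the actual derivatives near each point, so derivability
    and continuity transfer. *)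
Lemma C2_near_of_C2_on (R : realType) (n : nat) (G U : set (Cn R n)) (u : Cn R n -> R) (a : Cn R n)
    f1 f2 :
  open U -> U a -> U `<=` G -> C2_on U u f1 f2 -> C2_near G u a.
Proof.
move=> oU Ua UG [cf cf1 cf2 df1 df2]; exists U; split=> // v w.
have near_eq1 v' x : U x -> \forall y \near x, f1 v' y = 'D_v' u y.
  move=> Ux; have : \forall y \near x, U y by exact: open_nbhs_nbhs.
  by apply: filterS => y Uy; have [_ ->] := df1 v' y Uy.
have d2 x : U x -> is_derive x w ('D_v u) (f2 v w x).
  by move=> Ux; exact: (near_eq_is_derive (near_eq1 v x Ux) (df2 v w x Ux)).
split=> x Ux; first split.
- by have [] := df1 v x Ux.
- by have [] := d2 x Ux.
- have E : \forall y \near x, f2 v w y = 'D_w ('D_v u) y.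
    have : \forall y \near x, U y by exact: open_nbhs_nbhs.
    by apply: filterS => y Uy; have [_ ->] := d2 y Uy.
  have [_ Ex] := d2 x Ux; rewrite /prop_for /continuous_at Ex.
  by apply: cvg_trans (cf2 v w x Ux); apply: near_eq_cvg.
Qed.

(** * Powers of |z_j|^2, including at their zeros *)

Section power_of_modulus.
Context {R : realType} {n : nat} (j : 'I_n).
Implicit Types (x v w : Cn R n).

Notation q := (fun x : Cn R n => sqabs x j).

(** Twice the real inner product of the j-th coordinates. Being bilinear, it gives both the first
    derivative of |z_j|^2 and the constant second one. *)
Definition dsq v x := 2 * (re x j * re v j + im x j * im v j).

Lemma is_derive_re x v : is_derive x v (fun y => re y j) (re v j).
Proof.
apply/is_derive_lineE; rewrite (_ : (fun t => _) = (fun t : R => re x j + t * re v j)).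
  exact: is_derive_affine.
by apply/funext => t; rewrite /re !mxE.
Qed.

Lemma is_derive_im x v : is_derive x v (fun y => im y j) (im v j).
Proof.
apply/is_derive_lineE; rewrite (_ : (fun t => _) = (fun t : R => im x j + t * im v j)).
  exact: is_derive_affine.
by apply/funext => t; rewrite /im !mxE.
Qed.

Lemma is_derive_sqabs x v : is_derive x v q (dsq v x).
Proof.
rewrite (_ : q = (fun y => re y j) * (fun y => re y j) + (fun y => im y j) * (fun y => im y j));
    last first.
  by apply/funext => y; rewrite /sqabs !expr2.
by apply: (is_derive_eq (is_deriveD (is_deriveM (is_derive_re x v) (is_derive_re x v)) (is_deriveM
    (is_derive_im x v) (is_derive_im x v)))); rewrite /GRing.scale /= /dsq; ring.
Qed.

Lemma is_derive_dsq x v w : is_derive x w (dsq v) (dsq v w).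
Proof.
apply/is_derive_lineE; rewrite (_ : (fun t => _) = (fun t : R => dsq v x + t * dsq v w)).
  exact: is_derive_affine.
by apply/funext => t; rewrite /dsq /re /im !mxE; ring.
Qed.

Lemma continuous_dsq v : continuous (dsq v).
Proof.
move=> x; apply: cvgM; first exact: cvg_cst.
by apply: cvgD; (apply: cvgM; last exact: cvg_cst); [exact: continuous_re|exact: continuous_im].
Qed.

(** Cauchy-Schwarz for each factor. The factor [sqabs x j] on the right tames the singular power
    q^(p - 2) in the second derivative. *)
Lemma dsq_bound v w x : `|dsq v x * dsq w x| <= 4 * (sqabs v j + sqabs w j) * sqabs x j.
Proof.
have h u : dsq u x ^+ 2 <= 4 * (sqabs u j * sqabs x j).
  rewrite /dsq /sqabs; move: (re x j) (im x j) (re u j) (im u j) => a b c d.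
  by have := sqr_ge0 (a * d - b * c); lra.
have := h v; have := h w; rewrite ler_norml => h1 h2.
have := sqr_ge0 (dsq v x - dsq w x); have := sqr_ge0 (dsq v x + dsq w x).
have := mulr_ge0 (sqabs_ge0 v j) (sqabs_ge0 x j); have := mulr_ge0 (sqabs_ge0 w j) (sqabs_ge0 x j).
by move=> *; apply/andP; split; lra.
Qed.

(* At the zeros of q both sides of the formulas for the derivatives vanish when p > 1. *)
Lemma C2_on_sqabs_powR (U : set (Cn R n)) (p : R) : (forall x, U x -> 0 < q x \/ 1 <= p) ->
  C2_on U (fun x => q x `^ p) (fun v x => p * dsq v x * q x `^ (p - 1))
    (fun v w x => p * (dsq v w * q x `^ (p - 1) + (p - 1) * (dsq v x * dsq w x) * q x `^ (p - 1 -
        1))).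
Proof.
move=> Up; have q0 x : 0 <= q x by exact: sqabs_ge0.
have cq : continuous q by move=> x; exact: continuous_sqabs.
have cp x (r : R) : 0 < q x \/ 0 <= r -> {for x, continuous (fun y => q y `^ r)}.
  by move=> h; apply: continuous_at_powR => //; exact: cq.
have Up0 x : U x -> 0 < q x \/ 0 <= p by move=> /Up[|h]; [left|right; lra].
have Up1 x : U x -> 0 < q x \/ 0 <= p - 1 by move=> /Up[|h]; [left|right; lra].
(* For p = 1 the function is q itself, whose second derivative need not vanish at the zeros of q. *)
have [p1|p1] := eqVneq p 1.
  have -> : (fun x => q x `^ p) = q by apply/funext => x; rewrite p1 powRr1.
  have -> : (fun v x => p * dsq v x * q x `^ (p - 1)) = dsq.
    by apply/funext => v; apply/funext => x; rewrite p1 subrr powRr0 mul1r mulr1.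
  have -> : (fun v w x => p * (dsq v w * q x `^ (p - 1) + (p - 1) * (dsq v x * dsq w x) * q x `^ (p
      - 1 - 1))) =
     (fun v w _ => dsq v w).
    by apply/funext => v; apply/funext => w; apply/funext => x; rewrite p1 subrr powRr0 !mul0r
        addr0 mul1r mulr1.
  split=> [x Ux|v x Ux|v w x Ux|v x Ux|v w x Ux].
  - exact: cq.
  - exact: continuous_dsq.
  - exact: cvg_cst.
  - exact: is_derive_sqabs.
  - exact: is_derive_dsq.
have zero x : U x -> ~ 0 < q x -> [/\ q x = 0, 0 < p - 1 & forall v, dsq v x = 0].
  move=> Ux nq; have qx : q x = 0 by apply/eqP; rewrite eq_le q0 andbT leNgt; exact/negP.
  split=> //; first by have [//|h] := Up x Ux; rewrite subr_gt0 lt_neqAle eq_sym p1.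
  have /cabs_eq0[rx ix] : cabs x j = 0 by rewrite cabsE qx sqrtr0.
  by move=> v; rewrite /dsq rx ix !mul0r addr0 mulr0.
split=> [x Ux|v x Ux|v w x Ux|v x Ux|v w x Ux].
- exact/cp/Up0.
- by apply: cvgM; [apply: cvgM; [exact: cvg_cst|exact: continuous_dsq]|exact/cp/Up1].
- apply: cvgM; first exact: cvg_cst.
  apply: cvgD; first by apply: cvgM; [exact: cvg_cst|exact/cp/Up1].
  have [qx|nq] := pselect (0 < q x).
    apply: cvgM; last by apply: cp; left.
    by apply: cvgM; [exact: cvg_cst|apply: cvgM; exact: continuous_dsq].
  have [qx pp dx] := zero x Ux nq.
  (* By [dsq_bound] the singular term is at most C q^(p - 1), which tends to 0 because p > 1. *)
  pose C := `|p - 1| * (4 * (sqabs v j + sqabs w j)).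
  have lim0 : C * q y `^ (p - 1) @[y --> x] --> 0.
    rewrite -(mulr0 C); apply: cvgM; first exact: cvg_cst.
    have := cp x (p - 1) (or_intror (ltW pp)); rewrite /prop_for /continuous_at qx powR0//.
    by rewrite gt_eqF.
  rewrite /prop_for /continuous_at /= !dx !mulr0 mul0r.
  have lim0N : - (C * q y `^ (p - 1)) @[y --> x] --> 0 by rewrite -oppr0; exact: cvgN.
  apply: (squeeze_cvgr _ lim0N lim0); near=> y.
  rewrite -ler_norml normrM (normrM (p - 1)) (ger0_norm (powR_ge0 _ _)) /C.
  rewrite -[leLHS]mulrA -[leRHS]mulrA; apply: ler_wpM2l => //.
  have bnd := dsq_bound v w y; have [qy|qy] := eqVneq (q y) 0.
    move: bnd; rewrite qy mulr0 normr_le0 => /eqP ->; rewrite normr0 mul0r.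
    by rewrite mulr_ge0 ?powR_ge0// mulr_ge0// addr_ge0 ?sqabs_ge0.
  have -> : q y `^ (p - 1) = q y * q y `^ (p - 1 - 1) by rewrite mulr_powRB1.
  by rewrite [leRHS]mulrA; apply: ler_wpM2r => //; exact: powR_ge0.
- have [qx|nq] := pselect (0 < q x).
    apply: (is_derive_eq (is_derive_powR (f := q) p qx (is_derive_sqabs x v))); ring.
  have [qx pp dx] := zero x Ux nq.
  have pp' : 0 < p by lra.
  (* Splitting off one factor q, which vanishes at x, leaves a power known only to be continuous
     there. *)
  rewrite (_ : (fun x => q x `^ p) = (fun x => q x * q x `^ (p - 1))); last first.
    by apply/funext => y; rewrite mulr_powRB1.
  by apply: (is_derive_eq (is_derive_mul_eq0 (is_derive_sqabs x v) qx (cp x _ (or_intror (ltW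
      pp))))); rewrite dx !(mulr0, mul0r).
- have [qx|nq] := pselect (0 < q x).
    rewrite (_ : (fun x => p * dsq v x * q x `^ (p - 1)) =
       (fun x => p * dsq v x) * (fun x => q x `^ (p - 1)))//.
    have d1 : is_derive x w (fun x => p * dsq v x) (p * dsq v w).
      by apply: (is_derive_eq (is_deriveM (is_derive_cst p x w) (is_derive_dsq x v w))); rewrite
          /GRing.scale /=; ring.
    by apply: (is_derive_eq (is_deriveM d1 (is_derive_powR (f := q) (p - 1) qx (is_derive_sqabs x
        w)))); rewrite /GRing.scale /=; ring.
  have [qx pp dx] := zero x Ux nq.
  have d1 : is_derive x w (fun x => p * dsq v x) (p * dsq v w).
    by apply: (is_derive_eq (is_deriveM (is_derive_cst p x w) (is_derive_dsq x v w))); rewrite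
        /GRing.scale /=; ring.
  have z1 : p * dsq v x = 0 by rewrite dx mulr0.
  by apply: (is_derive_eq (is_derive_mul_eq0 d1 z1 (cp x _ (or_intror (ltW pp))))); rewrite !dx;
      ring.
Unshelve. all: by end_near.
Qed.

End power_of_modulus.

(** * The competitor belongs to the class *)

Section lower_bound.
Context {R : realType} {n : nat}.
Variables (alpha : 'I_n -> R) (a : Cn R n) (m : R).

(** Near a, a factor either has a nonvanishing base, or has exponent 0, or belongs to [Jset], where
    m <= alpha j makes its exponent at least 1. *)
Lemma zpow_sq_S_class : 0 < m -> Dalpha alpha a ->
  (forall j, j \in Jset alpha a -> m <= alpha j) -> (exists j, j \in Jset alpha a) ->
  S_class (Dalpha alpha) a (zpow_sq alpha m).
Proof.
move=> m0 Da mle [k]; rewrite inE => /andP[ak /eqP ck].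
split.
- by move=> z Dz; rewrite zpow_sq_ge0 zpow_sq_lt1.
- exact: psh_zpow_sq.
- apply/eqP; rewrite /zpow_sq (bigD1 k)//= -sqr_cabs ck expr0n powR0 ?mul0r//.
  by rewrite mulf_neq0 ?invr_neq0 ?gt_eqF.
(* The interior of P is the open set for the C^2 condition: on it the coordinates that are nonzero
   at a stay nonzero. *)
pose P y := Dalpha alpha y /\ forall j, 0 < sqabs a j -> 0 < sqabs y j.
have nearP : \forall y \near a, P y.
  have n1 : \forall y \near a, forall j, 0 < sqabs a j -> 0 < sqabs y j.
    apply: (@filter_forall _ _ (fun j y => 0 < sqabs a j -> 0 < sqabs y j) (nbhs a)) => j.
    have [aj|_] := ltP 0 (sqabs a j); last by near=> y.
    have /(@cvgr_gt _ _ _ _ _ (sqabs a j)) /(_ _ aj) := @continuous_sqabs _ _ j a.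
    by apply: filterS.
  have n2 : \forall y \near a, zpow_sq alpha m y < 1.
    by have /(@cvgr_lt _ _ _ _ _ (zpow_sq alpha m a)) /(_ _ (zpow_sq_lt1 m0 Da)) :=
        continuous_zpow_sq m0 Da.1.
  near=> y; have h1 : forall j, 0 < sqabs a j -> 0 < sqabs y j by near: y.
  have h2 : zpow_sq alpha m y < 1 by near: y.
  split=> //; split.
    by move=> j aj; rewrite cabs_neq0; apply: h1; rewrite -cabs_neq0; exact: Da.1.
  (* The condition zpow < 1 is recovered from zpow_sq < 1, whose continuity at a is available. *)
  rewrite ltNge; apply/negP => z1.
  have : 1 <= Num.sqrt (zpow_sq alpha m y).
    have e1 : (1 : R) `^ m^-1 = 1 by rewrite powR1.
    rewrite sqrt_zpow_sq// -[leLHS]e1; apply: ge0_ler_powR => //; rewrite ?nnegrE ?invr_ge0 ?(ltW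
        m0)//.
    exact: zpow_ge0.
  by rewrite leNgt -[X in _ < X]sqrtr1 ltr_sqrt// h2.
have [f1 [f2 C2]] : exists (f1 : Cn R n -> Cn R n -> R) (f2 : Cn R n -> Cn R n -> Cn R n -> R),
    C2_on (P^°) (zpow_sq alpha m) f1 f2.
  apply: C2_on_prod => j; have [aj|aj] := eqVneq (alpha j) 0.
    exists (fun _ _ => 0), (fun _ _ _ => 0).
    rewrite (_ : (fun x => _) = (fun=> 1)); first exact: C2_on_cst.
    by apply/funext => x; rewrite aj mul0r powRr0.
  do 2!eexists; apply: C2_on_sqabs_powR => x /interior_subset[_ Px].
  have [h|h] := ltP 0 (sqabs a j); first by left; exact: Px.
  have caj : cabs a j = 0.
    by apply/eqP; move: h; rewrite leNgt -cabs_neq0 negbK.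
  have ajp : 0 < alpha j.
    rewrite lt_neqAle eq_sym aj leNgt; apply/negP => /(Da.1 j).
    by rewrite caj eqxx.
  by right; rewrite ler_pdivlMr// mul1r mle// inE ajp caj eqxx.
apply: (C2_near_of_C2_on _ _ _ C2).
- exact: open_interior.
- exact: nearP.
- by move=> x /interior_subset[].
Unshelve. all: by end_near.
Qed.

End lower_bound.

(** * The exponent mu as a minimum, and the conclusion *)

Lemma mu_attained (R : realType) (n : nat) (alpha : 'I_n -> R) (a : Cn R n) :
  (0 < sigma alpha a)%N ->
  exists k, [/\ k \in Jset alpha a, mu alpha a = alpha k &
    forall j, j \in Jset alpha a -> alpha k <= alpha j].
Proof.
rewrite /sigma card_gt0 => /set0Pn[j0 j0J].
have [k kJ kmin] := @arg_minP _ _ _ j0 (mem (Jset alpha a)) alpha j0J.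
exists k; split => //.
pose S := [set alpha j | j in [set j | j \in Jset alpha a]].
have Sk : S (alpha k) by exists k.
have lb : lbound S (alpha k) by move=> _ [j /= jJ <-]; exact: kmin.
apply/eqP; rewrite eq_le; apply/andP; split.
  by apply: ge_inf => //; exists (alpha k).
by apply: lb_le_inf => //; exists (alpha k).
Qed.

Theorem theorem1 (R : realType) (n : nat) (alpha : 'I_n -> R) (a : Cn R n) :
  (2 <= n)%N ->
  (exists j, alpha j != 0) ->
  Dalpha alpha a ->
  (2 <= sigma alpha a)%N ->
  forall z, Dalpha alpha z ->
    sibony (Dalpha alpha) a z = zpow alpha z `^ (mu alpha a)^-1.
Proof.
move=> _ _ Da sig z Dz.
have [k [kJ -> kmin]] := mu_attained (ltnW sig).
have := kJ; rewrite inE => /andP[ak /eqP ck].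
pose S := [set x : R | exists2 u, S_class (Dalpha alpha) a u & x = Num.sqrt (u z)].
have ub : ubound S (zpow alpha z `^ (alpha k)^-1).
  by move=> _ [u uS ->]; exact: (sqrt_u_le ak Da ck uS Dz).
(* The upper bound is itself a member of S, so S is nonempty and its supremum is a maximum. *)
have Sz : S (zpow alpha z `^ (alpha k)^-1).
  exists (zpow_sq alpha (alpha k)); last by rewrite sqrt_zpow_sq.
  by apply: zpow_sq_S_class => //; exists k.
apply/eqP; rewrite eq_le; apply/andP; split.
  by apply: ge_sup => //; exists (zpow alpha z `^ (alpha k)^-1).
by apply: ub_le_sup => //; exists (zpow alpha z `^ (alpha k)^-1).
Qed.
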